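(* Let $0<a<b<\infty$ and, for $t\in[a,b]$, let $\pi_t(x)=x^{t-1}e^{-x}/\Gamma(t)$, $x\in\mathbb{R}_+$, be the Gamma density with shape parameter $t$ (with respect to Lebesgue measure on $\mathbb{R}_+$). Let $C>(b-a)^{-1/2}$ and $\alpha>1$. Then there exists $C^*>0$ such that, as $n\to\infty$, $$\inf_{\hat f\in\mathcal{S}_n}\ \sup_{f\in\tilde{\mathcal{C}}(\alpha,C)\cap\mathbb{H}_1}\pi_f^{\otimes n}\|\hat f-f\|_{\mathbb{H}}^2\ \ge\ C^*(\log n)^{-2\alpha}(1+o(1)).$$
   Context: $\Gamma$ is the Gamma function. $\mathbb{H}=L^2([a,b])$; $\mathbb{H}_1=\{f\in\mathbb{H}:f\ge0,\ \int_a^bf(t)\,dt=1\}$. For $f\in\mathbb{H}_1$, $\pi_f(x)=\int_a^bf(t)\pi_t(x)\,dt$ is the mixture density and $\pi_f^{\otimes n}$ denotes the joint distribution of $n$ i.i.d. observations with density $\pi_f$; $\pi_f^{\otimes n}\|\hat f-f\|^2_{\mathbb{H}}$ is the expectation of $\|\hat f(X_1,\dots,X_n)-f\|_{\mathbb{H}}^2$ under it. $\mathcal{S}_n$ is the set of all Borel functions from $\mathbb{R}^n$ to $\mathbb{H}$. For $r\in\mathbb{N}^*$, $h\in\mathbb{R}$ and $f:[a,b]\to\mathbb{R}$, let $\Delta_h^r(f,x)=\sum_{i=0}^r\binom{r}{i}(-1)^if(x+(i-r/2)h)$, with the convention $\Delta_h^r(f,x)=0$ if $x+rh/2\notin[a,b]$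 or $x-rh/2\notin[a,b]$. Let $\varphi(x)=\sqrt{(x-a)(b-x)}$ and $\omega_\varphi^r(f,t)_2=\sup_{0<h\le t}\|x\mapsto\Delta^r_{h\varphi(x)}(f,x)\|_{L^2([a,b])}$. With $r=[\alpha]+1$ ($[\alpha]$ the integer part of $\alpha$), $$\tilde{\mathcal{C}}(\alpha,C)=\{f\in\mathbb{H}:\|f\|_{\mathbb{H}}\le C\text{ and }\omega_\varphi^r(f,t)_2\le Ct^\alpha\text{ for all }t>0\}.$$ *)

(* Defs.v *)
From HB Require Import structures.
From mathcomp Require Import all_boot all_order all_algebra.
From mathcomp Require Import all_classical all_reals all_analysis.

Set Implicit Arguments.
Unset Strict Implicit.
Unset Printing Implicit Defensive.
Import Order.TTheory GRing.Theory Num.Theory.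
Import numFieldNormedType.Exports.
Local Open Scope classical_set_scope.
Local Open Scope ring_scope.

Section LebesguePower.
Variable R : realType.

Local Notation RT := (measurableTypeR R).

Definition tuple_cons n (p : n.-tuple RT * RT) : n.+1.-tuple RT :=
  [the n.+1.-tuple RT of p.2 :: p.1].

Lemma measurable_tuple_cons n : measurable_fun [set: n.-tuple RT * RT] (@tuple_cons n).
Proof. exact: measurable_cons. Qed.

(* Lebesgue measure on R^n: the n-fold product of the one-dimensional one,
   transported along R^n * R ~ R^(n+1); on R^0 it is a unit point mass. *)
Fixpoint lebesgue_power (n : nat) :
    {measure set (n.-tuple RT) -> \bar R} :=
  match n with
  | 0 => dirac ([tuple] : 0.-tuple RT)
  | n'.+1 =>
    measure_function_pushforward__canonical__measure_function_Measure
      (lebesgue_power n' \x (@lebesgue_measure R))%E (@measurable_tuple_cons n')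
  end.

End LebesguePower.

Section GammaMixture.
Variable R : realType.
Local Notation RT := (measurableTypeR R).
Local Notation mu := (@lebesgue_measure R).

Definition Gamma (t : R) : R :=
  \int[mu]_(x in `]0, +oo[) (x `^ (t - 1) * expR (- x)).

(* The density is extended by 0 to the negative half-line, so that the
   observations are real random variables. *)
Definition gamma_density (t x : R) : R :=
  if 0 <= x then x `^ (t - 1) * expR (- x) / Gamma t else 0.

Variables a b : R.

Definition lebesgue_on : {measure set RT -> \bar R} :=
  mrestr mu (@measurable_itv R `[a, b]).

(* L^2([a, b]): classes of functions modulo equality almost everywhere on
   [a, b].  An element coerces to one of its representatives, defined on all
   of R, and nothing below depends on the choice of the representative. *)
Definition L2 : Type := LspaceType2 lebesgue_on.

Definition L2norm (g : R -> R) : \bar R := 'N[lebesgue_on]_2%:E[EFin \o g].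

Definition L2fun (f : L2) : R -> R := f.

Definition L2dist (f g : L2) : \bar R := L2norm (L2fun f \- L2fun g).

Definition L2open (U : set L2) :=
  forall f, U f -> exists2 e : R, 0 < e &
    forall g, (L2dist g f < e%:E)%E -> U g.

Definition L2Borel : set (set L2) := <<s L2open >>.

Definition estimators (n : nat) : set (n.-tuple RT -> L2) :=
  [set fhat | forall B, L2Borel B -> measurable (fhat @^-1` B)].

Definition densities : set L2 :=
  [set f | {ae lebesgue_on, forall t, 0 <= L2fun f t} /\
           (\int[mu]_(t in `[a, b]) (L2fun f t)%:E = 1)%E].

Definition mixture_density (f : L2) (x : R) : R :=
  \int[mu]_(t in `[a, b]) (L2fun f t * gamma_density t x).

(* Expectation of |fhat(X_1, ..., X_n) - f|^2 when X_1, ..., X_n are i.i.d.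
   with density [mixture_density f], i.e. when (X_1, ..., X_n) has density
   x |-> \prod_i mixture_density f x_i with respect to Lebesgue measure. *)
Definition risk (n : nat) (fhat : n.-tuple RT -> L2) (f : L2) : \bar R :=
  (\int[lebesgue_power R n]_x
     (L2dist (fhat x) f ^+ 2 * (\prod_(i < n) mixture_density f (tnth x i))%:E))%E.

Definition sym_diff (r : nat) (h : R) (f : R -> R) (x : R) : R :=
  if (x + r%:R * h / 2 \in `[a, b]) && (x - r%:R * h / 2 \in `[a, b]) then
    \sum_(i < r.+1) 'C(r, i)%:R * (-1) ^+ i * f (x + (i%:R - r%:R / 2) * h)
  else 0.

Definition phi (x : R) : R := Num.sqrt ((x - a) * (b - x)).

Definition modulus (r : nat) (f : L2) (t : R) : \bar R :=
  ereal_sup [set L2norm (fun x => sym_diff r (h * phi x) (L2fun f) x)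
            | h in [set h : R | 0 < h <= t]].

Definition smooth_class (alpha C : R) : set L2 :=
  [set f | (L2norm (L2fun f) <= C%:E)%E /\
           forall t : R, 0 < t ->
             (modulus (Num.truncn alpha).+1 f t <= (C * t `^ alpha)%:E)%E].

Definition minimax_risk (alpha C : R) (n : nat) : \bar R :=
  ereal_inf [set ereal_sup [set risk fhat f
                           | f in smooth_class alpha C `&` densities]
            | fhat in @estimators n].

End GammaMixture.

(* Main.v *)
Require Import Defs.
From HB Require Import structures.
From mathcomp Require Import all_boot all_order all_algebra.
From mathcomp Require Import all_classical all_reals all_analysis.
From mathcomp Require Import generic_quotient measurable_realfun.
From mathcomp Require Import ring lra.
Set Implicit Arguments.
Unset Strict Implicit.
Unset Printing Implicit Defensive.
Import Order.TTheory GRing.Theory Num.Theory.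
Import numFieldNormedType.Exports.
Local Open Scope classical_set_scope.
Local Open Scope ring_scope.

(* Le Cam's two-point method around the uniform density f0 = 1 / (b - a).  The
   alternative is f1 = f0 + g, where g is a combination with weights w_j in
   [-1, 1] of 2M disjoint smooth bumps, of height of order M^-alpha, on a short
   window around the midpoint of [a, b].  The vanishing of the mass of g and of
   M - 1 moments of g(t) / Gamma(t) amounts to M linear constraints on w; an
   extreme point of the cube cut by these constraints has at least M weights of
   modulus 1, so that the L2 norm of g is also of order M^-alpha.  The vanishing
   moments cancel the Taylor polynomial of t |-> x^t at the midpoint, whence
   |pi_g| <= K e^(-2 M) pi_f0 pointwise.  With M of order log n the likelihood
   ratio of the two product measures is bounded below, and no estimator
   separates f0 from f1 at a scale smaller than M^-alpha. *)

(** * Smooth perturbations *)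

(** Three obstacles shape the construction. A nonzero solution of the moment equations could be
    concentrated on a few bumps, and [g] would then be too small in L2 for the rate; bounded
    weights, half of them saturated, exclude this, and disjoint supports forbid any cancellation.
    Next, [ln x] is unbounded on the half-line, so the Taylor remainder of x^(t - mid) is not
    uniformly small. Only its ratio to pi_f0 is, because the uniform density also charges shapes
    away from the midpoint on both sides: hence a short window for g inside a long support for f0.
    Last, the finite differences of g with step h phi(x) are bounded by the sup norm for long steps
    and by the r-th derivative for short ones, using phi <= b - a; bumps of width of order 1/M and
    height M^-alpha make both bounds fit under a multiple of t^alpha. The strict inequality on C
    puts f0 strictly inside the L2 ball and leaves room for g. The decay e^(-2 m), at most n^-2 once
    m >= ln n, beats the n factors of the likelihood. *)

(** Dimension count: the columns selecting the coordinates in [S] are appended to [A]; with fewer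
    than [N] columns in all, the left kernel is nonzero. *)
Lemma row_orthogonal_vanishing (F : fieldType) (N k : nat) (A : 'M[F]_(N, k))
    (S : {set 'I_N}) : (k + #|S| < N)%N ->
  exists u : 'rV[F]_N,
    [/\ u != 0, u *m A = 0 & forall j, j \in S -> u 0 j = 0].
Proof.
move=> ltN.
pose E : 'M[F]_(N, #|S|) := \matrix_(i, j) (i == enum_val j)%:R.
pose B := row_mx A E.
have kB : kermx B != 0.
  rewrite -mxrank_eq0 mxrank_ker -lt0n subn_gt0.
  exact: leq_ltn_trans (rank_leq_col _) ltN.
case/rowV0Pn: kB => u /sub_kermxP uB u0.
move: uB; rewrite mul_mx_row -(@row_mx0 _ 1 k #|S|) => /eq_row_mx[uA uE].
exists u; split => // j jS.
have := congr1 (fun M : 'rV_ _ => M 0 (enum_rank_in jS j)) uE.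
rewrite !mxE (bigD1 j) //= mxE enum_rankK_in // eqxx mulr1 big1 ?addr0 // => i ij.
by rewrite mxE enum_rankK_in // (negbTE ij) mulr0.
Qed.

(* Extreme-point argument: maximize the number of coordinates of modulus 1; if
   it were less than [N - k], one could move along a direction of the kernel
   supported on the other coordinates until one of them reaches modulus 1. *)
Lemma flat_row_vector (R : realFieldType) (N k : nat) (A : 'M[R]_(N, k)) :
  exists w : 'rV[R]_N, [/\ w *m A = 0, forall j : 'I_N, `|w 0 j| <= 1 &
    (N - k <= #|[set j : 'I_N | (`|w 0 j| == 1)%R]%SET|)%N].
Proof.
pose sat (w : 'rV[R]_N) := [set j : 'I_N | (`|w 0 j| == 1)%R]%SET.
pose P n := `[< exists w : 'rV[R]_N,
  [/\ w *m A = 0, forall j : 'I_N, `|w 0 j| <= 1 & #|sat w| = n] >].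
have exP : exists n, P n.
  exists #|sat 0|; apply/asboolP; exists 0; split => // [|j]; first by rewrite mul0mx.
  by rewrite mxE normr0 ler01.
have ubP n : P n -> (n <= N)%N.
  by move=> /asboolP[w [_ _ <-]]; rewrite -[leqRHS]card_ord max_card.
case: (ex_maxnP exP ubP) => n /asboolP[w [wA w1 wn]] nmax.
exists w; split => //; rewrite leqNgt; apply/negP => ltS.
have ltN : (k + #|sat w| < N)%N by rewrite -ltn_subRL.
have [u [u0 uA uS]] := row_orthogonal_vanishing A ltN.
have [j0 uj0] : exists j0, u 0 j0 != 0.
  apply/existsP; apply: contraNT u0; rewrite negb_exists => /forallP u_0.
  by apply/eqP/rowP => j; rewrite !mxE; apply/eqP; rewrite -[_ == _]negbK u_0.
(* [s j] is the time at which coordinate [j], moving along [u], reaches 1 in the direction of its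
   motion. Stopping at the smallest of these times keeps every coordinate in [-1, 1]. *)
pose s j := (1 - Num.sg (u 0 j) * w 0 j) / `|u 0 j|.
case: (@Order.TotalTheory.arg_minP _ _ _ j0 (fun j => u 0 j != 0) s uj0) => j1 uj1 smin.
have sgw j : -1 <= Num.sg (u 0 j) * w 0 j <= 1.
  rewrite -ler_norml normrM; apply: mulr_ile1 => //.
  by rewrite normr_sg; case: eqP; rewrite ?ler01.
have s1 : 0 <= s j1.
  by rewrite divr_ge0 // subr_ge0; case/andP: (sgw j1).
pose w' := w + s j1 *: u.
have w'E j : w' 0 j = w 0 j + s j1 * u 0 j by rewrite !mxE.
have w'sg j : u 0 j != 0 ->
    `|w' 0 j| = `|Num.sg (u 0 j) * w 0 j + s j1 * `|u 0 j| |.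
  move=> uj; rewrite [in X in _ + _ * X]normrEsg w'E mulrCA -mulrDr normrM.
  by rewrite normr_sg uj mul1r.
have w'1 j : `|w' 0 j| <= 1.
  have [uj|uj] := eqVneq (u 0 j) 0; first by rewrite w'E uj mulr0 addr0.
  rewrite w'sg // ler_norml.
  have := smin _ uj; rewrite {2}/s ler_pdivlMr ?normr_gt0 // => sj.
  have /andP[? ?] := sgw j.
  have : 0 <= s j1 * `|u 0 j| by rewrite mulr_ge0.
  by move=> ?; apply/andP; split; lra.
have : (#|sat w'| <= n)%N.
  apply: nmax; apply/asboolP; exists w'; split => //.
  by rewrite mulmxDl wA -scalemxAl uA scaler0 addr0.
(* The saturated coordinates do not move, since [u] vanishes there, and [j1] becomes saturated: the
   count grows strictly, against maximality. *)
apply/negP; rewrite -ltnNge -wn; apply: proper_card; apply/properP; split.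
  by apply/fintype.subsetP => j js; move: (js); rewrite !inE w'E uS // mulr0 addr0.
exists j1; last by apply/negP => /uS/eqP; rewrite (negbTE uj1).
by rewrite inE w'sg // /s divfK ?normr_eq0 // addrC subrK normr1.
Qed.

(** * Finite differences and a smooth bump *)

Lemma mvt_norm (R : realType) (f f' : R -> R) (K x y : R) :
  (forall z, is_derive z (1:R) f (f' z)) -> (forall z, `|f' z| <= K) ->
  `|f x - f y| <= K * `|x - y|.
Proof.
move=> df f'K.
wlog xy : x y / y <= x.
  move=> H; have [|/ltW] := leP y x; first exact: H.
  by move=> /H; rewrite distrC (distrC y).
have cf : {within `[y, x], continuous f}.
  apply: derivable_within_continuous => z _.
  by have := df z; apply: @ex_derive.
have [c _ ->] := MVT_segment xy (fun z _ => df z) cf.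
by rewrite normrM ler_wpM2r.
Qed.

(** Pascal's rule; it is the induction step on the order of a finite difference. *)
Lemma sum_binS_alt (R : comRingType) (r : nat) (f : nat -> R) :
  \sum_(i < r.+2) 'C(r.+1, i)%:R * (-1) ^+ i * f i =
  \sum_(i < r.+1) 'C(r, i)%:R * (-1) ^+ i * (f i - f i.+1).
Proof.
under [RHS]eq_bigr do rewrite mulrBr.
rewrite sumrB big_ord_recl.
under eq_bigr => i _ do rewrite binS natrD !mulrDl.
rewrite big_split /= addrA; congr (_ + _).
  rewrite [RHS]big_ord_recl big_ord_recr /= bin0 (bin_small (ltnSn r)) bin0.
  by rewrite !mul0r addr0.
by rewrite -sumrN; apply: eq_bigr => i _; rewrite /bump add1n exprS; ring.
Qed.

(** The successive derivatives are given as a family [D], so that the induction can replace it by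
    the family of its centred first differences [D']: this is again a chain of derivatives, and the
    mean value theorem turns the bound [K] into [K * |h|]. The half-steps of [D'] absorb the
    recentring of the nodes from [r.+1] to [r]. *)
Lemma finite_difference_le (R : realType) (r : nat) (D : nat -> R -> R)
    (K h x : R) :
  (forall i y, (i < r)%N -> is_derive y (1:R) (D i) (D i.+1 y)) ->
  (forall y, `|D r y| <= K) ->
  `|\sum_(i < r.+1)
      'C(r, i)%:R * (-1) ^+ i * D 0%N (x + (i%:R - r%:R / 2) * h)|
    <= K * `|h| ^+ r.
Proof.
elim: r D K => [|r IH] D K dD DK.
  by rewrite big_ord1 bin0 !expr0 !mul1r mulr1.
rewrite (sum_binS_alt _ (fun i => D 0%N (x + (i%:R - r.+1%:R / 2) * h))).
pose D' i y := D i (y + - (h / 2)) - D i (y + h / 2).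
have dD' i y : (i < r)%N -> is_derive y (1:R) (D' i) (D' i.+1 y).
  move=> ir.
  have dS c : is_derive y (1:R) (fun z => D i (z + c)) (D i.+1 (y + c)).
    have := dD i (y + c) (ltnW ir) => d1.
    have d2 : is_derive y (1:R) (fun z => z + c) (1 + 0) by apply: is_deriveD.
    have := @is_derive1_comp _ (D i) (fun z => z + c) y _ _ d1 d2.
    by rewrite addr0 mulr1.
  exact: is_deriveB.
have D'K y : `|D' r y| <= K * `|h|.
  apply: le_trans (@mvt_norm _ (D r) (D r.+1) K _ _ _ _) _ => //.
    by move=> z; apply: dD.
  rewrite (_ : y + - (h / 2) - (y + h / 2) = - h); last by field.
  by rewrite normrN.
have := IH D' _ dD' D'K.
rewrite -mulrA -exprS; apply: le_trans; rewrite le_eqVlt; apply/orP; left.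
apply/eqP; congr (`| _ |); apply: eq_bigr => i _; congr (_ * (D _ _ - D _ _)).
  by rewrite -(natr1 r); field.
by rewrite -(natr1 i) -(natr1 r); field.
Qed.

(** Squaring removes the kink of the positive part: the first-order remainder is at most h^2
    whatever the signs of [x] and [x + h]. This is what glues the bump to zero at the ends of its
    support. *)
Lemma is_derive_sqr_pos (R : realType) (x : R) :
  is_derive x (1:R) (fun s => Num.max 0 s ^+ 2) (2 * Num.max 0 x).
Proof.
pose f (s : R) := Num.max 0 s ^+ 2.
have fx h : `|f (x + h) - f x - h * (2 * Num.max 0 x)| <= h ^+ 2.
  rewrite /f ler_norml.
  by have [x0|x0] := leP 0 x; have [xh|xh] := leP 0 (x + h); apply/andP; split; nra.
have cl : h^-1 *: (f (h *: (1:R) + x) - f x) @[h --> 0^'] --> 2 * Num.max 0 x.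
  apply/cvgrPdist_le => e e0.
  near=> h.
  have h0 : h != 0 by near: h; exact: nbhs_dnbhs_neq.
  have -> : 2 * Num.max 0 x - h^-1 *: (f (h *: (1:R) + x) - f x) =
      - (h^-1 * (f (x + h) - f x - h * (2 * Num.max 0 x))).
    by rewrite /GRing.scale /= mulr1 (addrC h); field.
  rewrite normrN normrM normfV ler_pdivrMl ?normr_gt0 //.
  apply: le_trans (fx h) _.
  rewrite -real_normK ?num_real // expr2 ler_wpM2l //.
  near: h; apply: nbhs_dnbhs; exists e => //= h; rewrite /= sub0r normrN.
  exact: ltW.
apply: DeriveDef; last exact: cvg_lim cl.
by apply/cvg_ex; exists (2 * Num.max 0 x).
Unshelve. all: by end_near. Qed.

Lemma horner_deriv_mul_exp (R : comNzRingType) (q u : {poly R}) (j : nat) (y : R) :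
  (q * u ^+ j.+1)^`().[y] =
  (q^`().[y] * u.[y] + j.+1%:R * q.[y] * u^`().[y]) * u.[y] ^+ j.
Proof.
rewrite derivM deriv_exp !(hornerD, hornerM, hornerMn, horner_exp) exprS /=.
by rewrite -mulr_natl; ring.
Qed.

(** With U = y (1 - y), the bump is U^r times the squared positive part of U. Each derivative
    consumes one power of U and keeps the squared positive part as a factor, so that [D i] has the
    form q_i U^(r - i) pos^2 with q_i a polynomial, up to the order [r]. *)
Lemma smooth_bump (R : realType) (r : nat) :
  exists (D : nat -> R -> R) (K c : R), [/\ 0 < c,
    forall i y, (i < r)%N -> is_derive y (1:R) (D i) (D i.+1 y),
    forall y, `|D r y| <= K,
    forall i y, ~~ (0 < y < 1) -> D i y = 0 &
    (forall y, 0 <= D 0%N y <= 1) /\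
    (forall y : R, 4^-1 <= y <= 3 / 4 -> c <= D 0%N y)].
Proof.
have [U UE] : exists U : {poly R}, forall y, U.[y] = y * (1 - y).
  by exists ('X * (1 - 'X)) => y; rewrite !hornerE.
(* With k = r - i, the derivative of q U^k pos^2 is (q' U + (k + 2) q U') U^(k-1) pos^2: k comes
   from the power of U, and 2 from pos^2, through pos U = pos^2. *)
pose step i (q : {poly R}) := q^`() * U + (r - i + 2)%:R *: (q * U^`()).
pose q := fix q i := if i is i'.+1 then step i' (q i') else 1.
pose pos y := Num.max 0 U.[y].
pose D i y := (q i * U ^+ (r - i)).[y] * pos y ^+ 2.
have posN y : ~~ (0 < y < 1) -> pos y = 0.
  move=> y01; rewrite /pos UE; apply/max_idPl.
  by move: y01; rewrite negb_and -!leNgt => /orP[]?; nra.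
have pos1 y : 0 <= pos y <= 1.
  by rewrite /pos UE; have [h|h] := leP 0 (y * (1 - y)); apply/andP; split; nra.
(* The sum of the moduli of the coefficients bounds q_r on [0, 1], and 3/16 is the minimum of U on
   [1/4, 3/4]. *)
exists D, (\sum_(i < size (q r)) `|(q r)`_i|), ((3 / 16) ^+ (r + 2)); split.
- by rewrite exprn_gt0 //; lra.
- move=> i y ir.
  have dU : is_derive y (1:R) (fun y => pos y ^+ 2) (U^`().[y] * (2 * pos y)).
    have d1 := is_derive_sqr_pos U.[y].
    have d2 : is_derive y (1:R) (horner U) (U^`().[y]) by exact: is_derive_poly.
    have := @is_derive1_comp _ _ (horner U) y _ _ d1 d2.
    by rewrite mulrC.
  have dQ := is_derive_poly (q i * U ^+ (r - i)) y.
  have posU : pos y * U.[y] = pos y ^+ 2.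
    by rewrite /pos; have [u|u] := leP 0 U.[y]; rewrite ?expr2 ?mul0r.
  apply: (is_derive_eq (is_deriveM dQ dU)).
  rewrite /D /= /step (_ : (r - i.+1 = (r - i).-1)%N); last by rewrite subnS.
  case: (r - i)%N (subn_gt0 i r) => [|j _]; first by rewrite ir.
  rewrite horner_deriv_mul_exp /GRing.scale /= !hornerM !hornerD !hornerM hornerZ.
  rewrite hornerM !horner_exp natrD.
  transitivity (2 * (q i).[y] * U.[y] ^+ j * U^`().[y] * (pos y * U.[y]) +
    pos y ^+ 2 * (((q i)^`().[y] * U.[y] + j.+1%:R * (q i).[y] * U^`().[y])
      * U.[y] ^+ j)); first by rewrite exprS; ring.
  by rewrite posU; ring.
- move=> y; rewrite /D subnn expr0 mulr1 normrM.
  have [y01|/posN->] := boolP (0 < y < 1); last first.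
    by rewrite expr0n normr0 mulr0 sumr_ge0.
  have p1 : `|pos y ^+ 2| <= 1.
    by case/andP: (pos1 y) => p0 p1; rewrite ger0_norm ?exprn_ge0 // exprn_ile1.
  apply: le_trans (ler_piMr (normr_ge0 _) p1) _.
  rewrite horner_coef; apply: le_trans (ler_norm_sum _ _ _) _.
  apply: ler_sum => i _; rewrite normrM ler_piMr // normrX exprn_ile1 //.
  by case/andP: y01 => y0 y1; rewrite ger0_norm ltW.
- by move=> i y /posN; rewrite /D => ->; rewrite expr0n mulr0.
have D0 y : D 0%N y = U.[y] ^+ r * pos y ^+ 2.
  by rewrite /D /= mul1r subn0 horner_exp.
split=> y.
  have [|/posN] := boolP (0 < y < 1); last by rewrite D0 => ->; rewrite expr0n mulr0 lexx ler01.
  rewrite D0 UE => /andP[y0 y1].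
  have U0 : 0 <= y * (1 - y) <= 1 by apply/andP; split; nra.
  case/andP: U0 (pos1 y) => u0 u1 /andP[p0 p1].
  by rewrite mulr_ge0 ?exprn_ge0 //= mulr_ile1 ?exprn_ge0 ?exprn_ile1.
move=> /andP[y0 y1]; have U3 : 3 / 16 <= U.[y] by rewrite UE; nra.
have U0 : 0 <= U.[y] by apply: le_trans U3; lra.
rewrite D0 (_ : pos y = U.[y]); last by apply/max_idPr.
by rewrite -exprD lerXn2r // nnegrE //; lra.
Qed.

(** * Sums of disjoint translated bumps *)

Section Lattice.
Variable R : realType.
Implicit Types (V : R -> R) (s e t : R).

(** For [V] supported in ]0, 1[, the term of index j lives on the cell ]s + j e, s + (j + 1) e[. At
    most one term is then nonzero at each point, so sup bounds on [V] pass to the sum without a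
    factor [N]. *)
Definition lattice_sum N (w : 'I_N -> R) V s e t : R :=
  \sum_(j < N) w j * V ((t - s) / e - j%:R).

Lemma lattice_sumE N (w : 'I_N -> R) V s e t (j : 'I_N) :
  (forall y, ~~ (0 < y < 1) -> V y = 0) -> 0 < (t - s) / e - j%:R < 1 ->
  lattice_sum w V s e t = w j * V ((t - s) / e - j%:R).
Proof.
move=> V0 /andP[j0 j1]; rewrite /lattice_sum (bigD1 j) //= big1 ?addr0 // => i ij.
rewrite V0 ?mulr0 //; apply/negP => /andP[i0 i1].
have ij' : (i < j.+1)%N by rewrite -(ltr_nat R) -natr1; lra.
have ji' : (j < i.+1)%N by rewrite -(ltr_nat R) -natr1; lra.
by case/eqP: ij; apply/val_inj/eqP; rewrite eqn_leq -ltnS ij' -ltnS ji'.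
Qed.

Lemma lattice_sum_le N (w : 'I_N -> R) V K s e t :
  (forall y, ~~ (0 < y < 1) -> V y = 0) -> (forall y, `|V y| <= K) ->
  (forall j, `|w j| <= 1) -> `|lattice_sum w V s e t| <= K.
Proof.
move=> V0 VK w1.
have [[j jy]|H] := pselect (exists j : 'I_N, 0 < (t - s) / e - j%:R < 1).
  rewrite (lattice_sumE _ V0 jy) normrM; apply: le_trans (VK _).
  exact: ler_piMl.
rewrite /lattice_sum big1 ?normr0; first exact: le_trans (VK 0).
by move=> j _; rewrite V0 ?mulr0 //; apply/negP => h; apply: H; exists j.
Qed.

Lemma lattice_sum_supp N (w : 'I_N -> R) V s e t : 0 < e ->
  (forall y, ~~ (0 < y < 1) -> V y = 0) ->
  ~~ (s < t < s + N%:R * e) -> lattice_sum w V s e t = 0.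
Proof.
move=> e0 V0 ts; rewrite /lattice_sum big1 // => j _; rewrite V0 ?mulr0 //.
apply: contra ts => /andP[j0 j1]; apply/andP; split.
  rewrite -subr_gt0 -(pmulr_lgt0 _ (_ : 0 < e^-1)) ?invr_gt0 //.
  by apply: le_lt_trans (_ : j%:R < _); rewrite // -subr_gt0.
rewrite -ltrBlDl -ltr_pdivrMr //.
apply: lt_le_trans (_ : j%:R + 1 <= _); first by rewrite -ltrBlDl.
by rewrite natr1 ler_nat.
Qed.

Lemma is_derive_lattice_sum N (w : 'I_N -> R) (V V' : R -> R) s e t :
  (forall y, is_derive y (1:R) V (V' y)) ->
  is_derive t (1:R) (lattice_sum w V s e) (e^-1 * lattice_sum w V' s e t).
Proof.
move=> dV.
have dj (j : 'I_N) : is_derive t (1:R) (fun t => w j * V ((t - s) / e - j%:R))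
    (w j * (e^-1 * V' ((t - s) / e - j%:R))).
  have d2 : is_derive t (1:R) (fun t : R => e^-1 *: t + (- (s / e) - j%:R)) (e^-1).
    by apply: is_derive_eq; rewrite addr0 /GRing.scale /= mulr1.
  have d1 := dV (e^-1 *: t + (- (s / e) - j%:R)).
  have d := @is_derive1_comp _ V (fun t : R => e^-1 *: t + (- (s / e) - j%:R)) t _ _ d1 d2.
  have E u : e^-1 *: u + (- (s / e) - j%:R) = (u - s) / e - j%:R.
    by rewrite /GRing.scale /=; ring.
  have {}d : is_derive t (1:R) (fun t => V ((t - s) / e - j%:R)) (e^-1 * V' ((t - s) / e - j%:R)).
    rewrite -E [e^-1 * _]mulrC; have -> // : (fun t => V ((t - s) / e - j%:R)) =
      (V \o (fun t : R => e^-1 *: t + (- (s / e) - j%:R))).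
    by apply/funext => u /=; rewrite E.
  exact: is_deriveZ.
rewrite /lattice_sum mulr_sumr.
under eq_bigr do rewrite mulrCA.
have -> : (fun t => \sum_(j < N) w j * V ((t - s) / e - j%:R)) =
  \sum_(j < N) (fun t => w j * V ((t - s) / e - j%:R)).
  by apply/funext => u; rewrite fct_sumE.
exact: is_derive_sum.
Qed.

End Lattice.

(** The i-th derivative of the sum is e^-i times the sum built on [D i], whose supports are again
    disjoint: this is why [K] depends neither on the number of cells nor on the weights. *)
Lemma smooth_lattice_bump (R : realType) (r : nat) : (0 < r)%N ->
  exists (V : R -> R) (K c : R), [/\ 0 < c,
    continuous V,
    (forall y, ~~ (0 < y < 1) -> V y = 0) /\ (forall y, 0 <= V y <= 1),
    forall y : R, 4^-1 <= y <= 3 / 4 -> c <= V y &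
    forall N (w : 'I_N -> R) s e h x, 0 < e -> (forall j, `|w j| <= 1) ->
      `|\sum_(i < r.+1) 'C(r, i)%:R * (-1) ^+ i *
          lattice_sum w V s e (x + (i%:R - r%:R / 2) * h)|
        <= K * (`|h| / e) ^+ r].
Proof.
move=> r0; have [D [K [c [c0 dD DK D0 [D1 Dc]]]]] := smooth_bump R r.
exists (D 0%N), K, c; split => //.
- move=> y; apply: differentiable_continuous; apply/derivable1_diffP.
  exact: (@ex_derive _ _ _ _ _ _ _ (dD 0%N y r0)).
- by split => // y; exact: D0.
- move=> N w s e h x e0 w1.
  pose G i t := e ^- i * lattice_sum w (D i) s e t.
  rewrite expr_div_n mulrA mulrAC.
  have -> : lattice_sum w (D 0%N) s e = G 0%N.
    by apply/funext => t; rewrite /G expr0 invr1 mul1r.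
  apply: finite_difference_le => [i y ir|y]; last first.
    rewrite /G normrM ger0_norm ?invr_ge0 ?exprn_ge0 ?(ltW e0) // mulrC.
    rewrite ler_wpM2r ?invr_ge0 ?exprn_ge0 ?(ltW e0) //.
    by apply: lattice_sum_le => //; exact: D0.
  have := is_derive_lattice_sum w s e y (fun z => dD i z ir).
  move=> /(@is_deriveZ _ _ _ _ (e ^- i)) H.
  apply: (is_derive_eq H).
  rewrite /G /GRing.scale /=. by rewrite mulrA exprS invfM [e^-1 * _]mulrC.
Qed.

Lemma continuous_lattice_sum (R : realType) N (w : 'I_N -> R) (V : R -> R) s e :
  continuous V -> continuous (lattice_sum w V s e).
Proof.
move=> cV t; rewrite /lattice_sum; apply: cvg_big => //.
  by apply: add_continuous.
move=> j _; apply: cvgMr; apply: continuous_comp; last exact: cV.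
by apply: cvgB; [apply: cvgMl; apply: cvgB; [exact: cvg_id|exact: cvg_cst]|exact: cvg_cst].
Qed.

(** Only the cells with a weight of modulus 1 are kept, and in each of them only the middle half
    [Q j], of length e / 2, where the bump is at least [c]. *)
Lemma lattice_sum_sqr_integral_ge (R : realType) (a b : R) N (w : 'I_N -> R)
    (V : R -> R) (c s e : R) :
  0 <= c -> 0 < e -> a <= s -> s + N%:R * e <= b -> continuous V ->
  (forall y, ~~ (0 < y < 1) -> V y = 0) ->
  (forall y : R, 4^-1 <= y <= 3 / 4 -> c <= V y) ->
  ((c ^+ 2 * (e / 2) * #|[set j | `|w j| == 1]%SET|%:R)%:E <=
   \int[lebesgue_on a b]_t (lattice_sum w V s e t ^+ 2)%:E)%E.
Proof.
move=> c0 e0 as_ sb cV V0 Vc.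
pose J := [set j | `|w j| == 1]%SET.
pose Q (j : 'I_N) := [set` `[s + (j%:R + 4^-1) * e, s + (j%:R + 3 / 4) * e]%R].
have QE j t : Q j t = (s + (j%:R + 4^-1) * e <= t <= s + (j%:R + 3 / 4) * e) :> Prop.
  by rewrite /Q /= in_itv.
have QV j t : Q j t -> 4^-1 <= (t - s) / e - j%:R <= 3 / 4.
  rewrite QE => /andP[t1 t2]; apply/andP; split.
    by rewrite lerBrDl ler_pdivlMr // lerBrDl.
  by rewrite lerBlDl ler_pdivrMr // lerBlDl.
have muQ j : lebesgue_on a b (Q j) = (e / 2)%:E.
  transitivity (@lebesgue_measure R (Q j `&` [set` `[a, b]%R])) => //.
  rewrite setIidl.
    rewrite lebesgue_measure_itv /= lte_fin ltrD2l ltr_pM2r // ltrD2l.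
    rewrite ifT; last by lra.
    by rewrite -EFinB; congr EFin; lra.
  move=> t; rewrite QE /= in_itv /= => /andP[t1 t2]; apply/andP; split.
    apply: (le_trans as_); apply: le_trans t1.
    by rewrite lerDl mulr_ge0 ?(ltW e0) // addr_ge0.
  apply: (le_trans t2); apply: le_trans sb; rewrite lerD2l ler_wpM2r ?(ltW e0) //.
  apply: (@le_trans _ _ (j.+1%:R)); last by rewrite ler_nat.
  by rewrite -natr1; lra.
apply: (@le_trans _ _ (\int[lebesgue_on a b]_t
   (\sum_(j <- enum J) (c ^+ 2)%:E * (\1_(Q j) t)%:E))%E).
  rewrite ge0_integral_sum //; last first.
  - by move=> j t _; rewrite -EFinM lee_fin mulr_ge0 ?sqr_ge0.
  - move=> j; apply/measurable_EFinP; apply: measurable_funM => //.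
    by apply: measurable_indic; exact: measurable_itv.
  rewrite (eq_bigr (fun=> ((c ^+ 2 * (e / 2))%:E))); last first.
    move=> j _; rewrite ge0_integralZl_EFin ?sqr_ge0 //; last first.
    - by apply/measurable_EFinP; apply: measurable_indic; exact: measurable_itv.
    by rewrite integral_indic //; [rewrite setIT muQ|exact: measurable_itv].
  by rewrite big_enum /= sumEFin lee_fin sumr_const -[_ *+ #|J|]mulr_natr.
apply: ge0_le_integral => //.
- by move=> t _; apply: sume_ge0 => j _; rewrite -EFinM lee_fin mulr_ge0 ?sqr_ge0.
- apply: emeasurable_sum => j; apply/measurable_EFinP; apply: measurable_funM => //.
  by apply: measurable_indic; exact: measurable_itv.
- apply/measurable_EFinP; apply: measurable_funX.
  by apply: continuous_measurable_fun; exact: continuous_lattice_sum.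
move=> t _; rewrite big_enum /=.
have [[j [jJ Qj]]|H] := pselect (exists j, j \in J /\ Q j t); last first.
  rewrite big1 ?lee_fin ?sqr_ge0 // => j jJ; rewrite indicE memNset ?mule0 //.
  by move=> Qj; apply: H; exists j.
have jc := QV _ _ Qj.
have j01 i : 4^-1 <= (t - s) / e - i%:R <= 3 / 4 -> 0 < (t - s) / e - i%:R < 1.
  by move=> /andP[? ?]; apply/andP; split; lra.
rewrite (lattice_sumE _ V0 (j01 _ jc)) (bigD1 j) //= big1 ?adde0.
  rewrite indicE mem_set // mule1 lee_fin exprMn.
  rewrite -[w j ^+ 2]real_normK ?num_real //.
  move: jJ; rewrite inE => /eqP ->; rewrite expr1n mul1r lerXn2r ?nnegrE //.
    by apply: le_trans c0 _; apply: Vc.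
  exact: Vc.
move=> i /andP[_ ij]; rewrite indicE memNset ?mule0 // => Qi.
have := lattice_sumE (fun=> 1) V0 (j01 _ (QV _ _ Qi)).
move: (j01 _ (QV _ _ Qi)) (j01 _ jc) => /andP[i0 i1] /andP[k0 k1].
have ij' : (i < j.+1)%N by rewrite -(ltr_nat R) -natr1; lra.
have ji' : (j < i.+1)%N by rewrite -(ltr_nat R) -natr1; lra.
by case/eqP: ij; apply/val_inj/eqP; rewrite eqn_leq -ltnS ij' -ltnS ji'.
Qed.

(** * Null sets under the maps x + c phi(x) *)

(** [N] is covered by open intervals of small total length. The part of [S] sent into one of them
    lies within [L] times its length of any of its own points, hence in an interval at most 2 L
    times as long. *)
Lemma negligible_expanding_preimage (R : realType) (T : R -> R) (S N : set R)
    (L : R) :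
  (forall x y, S x -> S y -> `|x - y| <= L * `|T x - T y|) ->
  (@lebesgue_measure R).-negligible N ->
  (@lebesgue_measure R).-negligible (S `&` T @^-1` N).
Proof.
wlog L0 : L / 0 < L.
  move=> H TL; apply: (H (`|L| + 1)); first exact: ltr_wpDl.
  move=> x y Sx Sy; apply: le_trans (TL _ _ Sx Sy) _.
  by rewrite ler_wpM2r // (le_trans (ler_norm _)) // lerDl.
move=> TL /negligible_outer_measure N0; apply/negligible_outer_measure.
apply/eqP; rewrite eq_le outer_measure_ge0 andbT.
apply/lee_addgt0Pr => /= e e0; rewrite add0e.
pose l := @wlength R idfun.
pose e' := e / (2 * L).
have e'0 : 0 < e' by rewrite divr_gt0 // mulr_gt0.
have [F [Fitv NF] Fe] : exists2 F, open_itv_cover N F &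
    (\sum_(0 <= k <oo) l (F k) <= e'%:E)%E.
  have := N0; rewrite outer_measure_open_itv_cover => Ninf.
  have : ereal_inf [set (\sum_(0 <= k <oo) l (F k))%E | F in open_itv_cover N]
    \is a fin_num by rewrite Ninf.
  move=> /lb_ereal_inf_adherent-/(_ _ e'0)[_ /= [F cF <-]].
  by rewrite Ninf add0e => /ltW; exists F.
pose SF k := S `&` T @^-1` (F k).
(* The covering interval is centred at an arbitrary point of the slice [SF k], when there is one. *)
pose G k : set R := if pselect (SF k !=set0) is left h then
   let s := projT1 (cid h) in [set` `[s - L * fine (l (F k)), s + L * fine (l (F k))]%R]
   else set0.
have lF k : (0 <= l (F k) < +oo)%E.
  have [ab ->] := Fitv k; rewrite /l wlength_itv /= lte_fin.
  case: ifPn => [/ltW h|_]; last by rewrite lexx ltry.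
  by rewrite -EFinB lee_fin subr_ge0 h ltry.
have lFE k : l (F k) = (fine (l (F k)))%:E.
  by rewrite fineK // ge0_fin_numE; case/andP: (lF k).
have SG k : SF k `<=` G k.
  move=> x SFx; rewrite /G; case: pselect => [h|[]]; last by exists x.
  case: cid => s [Ss Fs] /=; rewrite in_itv /= -ler_distl distrC.
  case: SFx => Sx Fx; rewrite distrC; apply: le_trans (TL _ _ Sx Ss) _.
  rewrite ler_wpM2l ?(ltW L0) //.
  move: Fs Fx; rewrite /=; have [ab ->] := Fitv k.
  rewrite /l wlength_itv /= !in_itv /= lte_fin => /andP[s1 s2] /andP[x1 x2].
  rewrite (lt_trans s1 s2) /= ler_distl; apply/andP; split; lra.
have L20 : (0 <= (2 * L)%:E)%E by rewrite lee_fin mulr_ge0 // ltW.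
have muG k : ((@lebesgue_measure R) (G k) <= (2 * L)%:E * l (F k))%E.
  rewrite /G; case: pselect => h; last first.
    by rewrite measure0; apply: mule_ge0 => //; case/andP: (lF k).
  case: cid => s /= _; rewrite lebesgue_measure_itv /= lte_fin.
  case: ifPn => _; last first.
    by apply: mule_ge0 => //; case/andP: (lF k).
  by rewrite lFE /= -EFinM -EFinB lee_fin le_eqVlt; apply/orP; left; apply/eqP; ring.
apply: (@le_trans _ _ (l^* (\bigcup_k G k))%mu).
  apply: le_outer_measure => x [Sx Nx]; have [k _ Fk] := NF _ Nx.
  by exists k => //; apply: SG.
apply: (le_trans (outer_measure_sigma_subadditive (@lebesgue_measure R) G)).
apply: (@le_trans _ _ (\sum_(0 <= k <oo) (2 * L)%:E * l (F k))%E).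
  by apply: lee_nneseries => k _ *; [exact: measure_ge0|exact: muG].
rewrite nneseriesZl; last by move=> k _; case/andP: (lF k).
apply: (@le_trans _ _ ((2 * L)%:E * e'%:E)%E).
  by rewrite lee_wpmul2l.
by rewrite -EFinM lee_fin /e' mulrC divfK // mulf_neq0 // gt_eqF.
Qed.

Lemma phi_le (R : realType) (a b x : R) : x \in `[a, b] -> phi a b x <= b - a.
Proof.
rewrite in_itv /= => /andP[ax xb].
rewrite -(@ler_pXn2r _ 2) ?nnegrE ?sqrtr_ge0 ?subr_ge0 ?(le_trans ax xb) //.
rewrite sqr_sqrtr; last by rewrite mulr_ge0 // subr_ge0.
by rewrite expr2 ler_pM ?subr_ge0 // lerB.
Qed.

(* With [T x = x + c phi x] and [psi x = phi x + c ((a + b) / 2 - x)], one has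
   [(T x - T y) (phi x + phi y) = (x - y) (psi x + psi y)], so that [T] has a
   Lipschitz inverse on [psi >= 1/n] and on [psi <= -1/n]; [psi] has finitely
   many zeros. *)
Lemma negligible_phi_preimage (R : realType) (a b c : R) (N : set R) :
  a < b -> (@lebesgue_measure R).-negligible N ->
  (@lebesgue_measure R).-negligible
    [set x | x \in `[a, b] /\ N (x + c * phi a b x)].
Proof.
move=> ab N0.
pose s := (a + b) / 2.
pose psi x := phi a b x + c * (s - x).
pose T x := x + c * phi a b x.
have phi2 x : x \in `[a, b] -> phi a b x ^+ 2 = (x - a) * (b - x).
  rewrite in_itv /= => /andP[ax xb].
  by rewrite sqr_sqrtr // mulr_ge0 // subr_ge0.
have phi0 x : 0 <= phi a b x by exact: sqrtr_ge0.
have key x y : x \in `[a, b] -> y \in `[a, b] ->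
    (T x - T y) * (phi a b x + phi a b y) = (x - y) * (psi x + psi y).
  move=> /phi2 px /phi2 py.
  have -> : (T x - T y) * (phi a b x + phi a b y) =
    (x - y) * (phi a b x + phi a b y) + c * (phi a b x ^+ 2 - phi a b y ^+ 2).
    by rewrite /T; ring.
  by rewrite px py /psi /s; field.
pose S n := [set x | x \in `[a, b] /\ n.+1%:R^-1 <= psi x].
pose S' n := [set x | x \in `[a, b] /\ psi x <= - n.+1%:R^-1].
(* If psi x and psi y have the same sign and modulus at least 1/(n+1), then |psi x + psi y| >=
   2/(n+1), while phi x + phi y <= 2 (b - a); [key] then gives the constant (b - a)(n + 1). *)
have expand x y n : x \in `[a, b] -> y \in `[a, b] ->
    2 * n.+1%:R^-1 <= `|psi x + psi y| ->
    `|x - y| <= ((b - a) * n.+1%:R) * `|T x - T y|.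
  move=> xab yab le.
  have h : `|x - y| * (2 * n.+1%:R^-1) <= `|T x - T y| * (2 * (b - a)).
    apply: le_trans (_ : `|x - y| * `|psi x + psi y| <= _).
      by rewrite ler_wpM2l.
    rewrite -normrM -key // normrM ler_wpM2l // ger0_norm ?addr_ge0 //.
    by rewrite mulr_natl mulr2n lerD // phi_le.
  have n0 : 0 < n.+1%:R :> R by rewrite ltr0n.
  rewrite -(@ler_pM2r _ (2 * n.+1%:R^-1)) ?mulr_gt0 ?invr_gt0 //.
  apply: le_trans h _; rewrite le_eqVlt; apply/orP; left; apply/eqP.
  by field; rewrite gt_eqF.
have nS n : (@lebesgue_measure R).-negligible (S n `&` T @^-1` N).
  apply: (@negligible_expanding_preimage _ _ _ _ ((b - a) * n.+1%:R)) N0 => x y [xab px] [yab py].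
  apply: (expand _ _ n) => //; have n0 : 0 < n.+1%:R^-1 :> R by rewrite invr_gt0 ltr0n.
  move: (n.+1%:R^-1) (psi x) (psi y) n0 px py => q u v n0 /= px py.
  by rewrite ger0_norm; lra.
have nS' n : (@lebesgue_measure R).-negligible (S' n `&` T @^-1` N).
  apply: (@negligible_expanding_preimage _ _ _ _ ((b - a) * n.+1%:R)) N0 => x y [xab px] [yab py].
  apply: (expand _ _ n) => //; have n0 : 0 < n.+1%:R^-1 :> R by rewrite invr_gt0 ltr0n.
  move: (n.+1%:R^-1) (psi x) (psi y) n0 px py => q u v n0 /= px py.
  by rewrite ler0_norm; lra.
pose Z := [set x | x \in `[a, b] /\ psi x = 0].
have nZ : (@lebesgue_measure R).-negligible Z.
  (* At a zero of psi, phi^2 = c^2 (x - s)^2, and always phi^2 = ((b - a)/2)^2 - (x - s)^2 on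
     [a, b]; hence (x - s)^2 = d^2. *)
  pose d := Num.sqrt (((b - a) / 2) ^+ 2 / (1 + c ^+ 2)).
  have c1 : 0 < 1 + c ^+ 2 by rewrite ltr_pwDl // sqr_ge0.
  have : (@lebesgue_measure R).-negligible ([set s - d] `|` [set s + d]).
    by apply: negligibleU; apply/negligibleP => //; exact: lebesgue_measure_set1.
  apply: negligibleS.
  move=> x [xab /eqP]; rewrite /psi addr_eq0 => /eqP p.
  have := phi2 _ xab; rewrite p sqrrN => e.
  have : (x - s) ^+ 2 = d ^+ 2.
    rewrite /d sqr_sqrtr; last by rewrite divr_ge0 ?sqr_ge0 // ltW.
    apply: (mulIf (lt0r_neq0 c1)); rewrite divfK ?gt_eqF //.
    have -> : (x - s) ^+ 2 * (1 + c ^+ 2) = (x - s) ^+ 2 + (c * (s - x)) ^+ 2.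
      by ring.
    by rewrite e /s; field.
  move=> /eqP; rewrite eqf_sqr => /orP[]/eqP h; [right|left] => /=.
    by rewrite -h; ring.
  by rewrite -[d]opprK -h; ring.
have : (@lebesgue_measure R).-negligible (Z `|` ((\bigcup_n (S n `&` T @^-1` N))
    `|` \bigcup_n (S' n `&` T @^-1` N))).
  apply: negligibleU => //; apply: negligibleU; exact: negligible_bigcup.
apply: negligibleS.
move=> x [xab Nx].
have inv_le z : 0 < z -> exists n, n.+1%:R^-1 <= z :> R.
  move=> z0; exists (Num.truncn z^-1).
  rewrite -[leRHS]invrK lef_pV2 ?posrE ?invr_gt0 ?ltr0n //.
  exact/ltW/truncnS_gt.
have [px|px|/esym px] := ltgtP 0 (psi x); last by left.
- by right; left; have [n le] := inv_le _ px; exists n.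
- right; right; have [|n le] := inv_le (- psi x); first by rewrite oppr_gt0.
  by exists n => //; split => //; split => //; rewrite lerNr.
Qed.

(** * Gamma densities and their mixtures *)

Lemma series_exp_le_expR (R : realType) (x : R) (n : nat) :
  0 <= x -> \sum_(0 <= k < n) x ^+ k / k`!%:R <= expR x.
Proof.
move=> x0; have := @nondecreasing_cvgn_le _ (series (exp_coeff x)) _ (is_cvg_series_exp_coeff x) n.
rewrite /series /exp_coeff /=; apply.
by apply: nondecreasing_series => k _ _ /=; rewrite divr_ge0 // exprn_ge0.
Qed.

(* The tail is dominated termwise: [|y|^k <= s^-m (s |y|)^k] for [m <= k]. *)
Lemma expR_taylor_remainder (R : realType) (s y : R) (m : nat) : 1 <= s ->
  `|expR y - \sum_(k < m) y ^+ k / k`!%:R| <= s ^- m * expR (s * `|y|).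
Proof.
move=> s1; have s0 : 0 < s by apply: lt_le_trans s1.
have cl : series (exp_coeff y) n - \sum_(0 <= k < m) y ^+ k / k`!%:R @[n --> \oo] -->
    expR y - \sum_(0 <= k < m) y ^+ k / k`!%:R.
  by apply: cvgB; [exact: is_cvg_series_exp_coeff|exact: cvg_cst].
rewrite -(big_mkord xpredT (fun k => y ^+ k / k`!%:R)).
apply: (cvgr_to_le (cvg_norm cl)); near=> n.
have mn : (m <= n)%N by near: n; exact: nbhs_infty_ge.
rewrite /series /exp_coeff /= (big_cat_nat _ mn) //= addrAC subrr add0r.
apply: le_trans (ler_norm_sum _ _ _) _.
have sy : 0 <= s * `|y| by rewrite mulr_ge0 // ltW.
apply: le_trans (ler_wpM2l _ (series_exp_le_expR n sy)); last first.
  by rewrite invr_ge0 exprn_ge0 // ltW.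
rewrite [X in _ <= _ * X](big_cat_nat _ mn) //= mulrDr.
apply: (@le_trans _ _ (\sum_(m <= k < n) s ^- m * ((s * `|y|) ^+ k / k`!%:R))).
  rewrite !big_seq; apply: ler_sum => k; rewrite mem_index_iota => /andP[mk _].
  rewrite normrM normrX (@ger0_norm _ (_ ^-1)) ?invr_ge0 // mulrA.
  rewrite ler_wpM2r ?invr_ge0 // exprMn mulrA ler_peMl ?exprn_ge0 //.
  by rewrite -(subnK mk) exprD mulrCA mulVf ?expf_neq0 ?gt_eqF // mulr1 exprn_ege1.
rewrite -mulr_sumr lerDr mulr_ge0 ?invr_ge0 ?exprn_ge0 ?(ltW s0) //.
by apply: sumr_ge0 => k _; rewrite divr_ge0 // exprn_ge0.
Unshelve. all: by end_near. Qed.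

(** * Finiteness, bounds and measurability of the Gamma function *)

(** The fundamental theorem of calculus on the compact intervals [1/(n+2), n+2], which exhaust the
    half-line, bounds the integral of [F'] by the oscillation of [F]. The shift by 2 makes each
    interval nondegenerate, including for n = 0. *)
Lemma ge0_integral_0y_le (R : realType) (f F F' : R -> R) (M : R) :
  measurable_fun (`]0, +oo[%classic : set R) f ->
  (forall x : R, 0 < x -> 0 <= f x <= F' x) ->
  (forall x : R, 0 < x -> is_derive x (1:R) F (F' x)) ->
  (forall x : R, 0 < x -> {for x, continuous F'}) ->
  (forall x : R, 0 < x -> `|F x| <= M) ->
  (\int[@lebesgue_measure R]_(x in [set` `]0, +oo[%R]) (f x)%:E <= (2 * M)%:E)%E.
Proof.
move=> mf fF' dF cF' FM.
pose I n := [set` `[n.+2%:R^-1, n.+2%:R : R]%R].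
have n2 n : 0 < n.+2%:R^-1 :> R by rewrite invr_gt0 ltr0n.
have I0 n x : I n x -> 0 < x.
  by rewrite /I /= in_itv /= => /andP[h _]; apply: lt_le_trans h.
have UI : \bigcup_n I n = [set` `]0, +oo[%R].
  apply/seteqP; split => [x [n _ /I0]|x]; first by rewrite /= in_itv /= andbT.
  rewrite /= in_itv /= andbT => x0.
  exists (Num.truncn (x + x^-1)) => //; rewrite /I /= in_itv /=.
  have xV0 : 0 < x^-1 by rewrite invr_gt0.
  have h : x + x^-1 < (Num.truncn (x + x^-1)).+2%:R.
    by apply: lt_trans (truncnS_gt _) _; rewrite ltr_nat.
  apply/andP; split; last by apply: ltW; apply: le_lt_trans h; rewrite lerDl ltW.
  rewrite -[leRHS]invrK lef_pV2 ?posrE ?ltr0n //.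
  by apply: ltW; apply: le_lt_trans h; rewrite lerDr ltW.
have ndI : nondecreasing_seq I.
  apply/nondecreasing_seqP => n; apply/subsetPset => x.
  rewrite /I /= !in_itv /= => /andP[h1 h2]; apply/andP; split.
    by apply: le_trans h1; rewrite lef_pV2 ?posrE ?ltr0n // ler_nat.
  by apply: le_trans h2 _; rewrite ler_nat.
have mI n : measurable (I n) by exact: measurable_itv.
have mfI n : measurable_fun (I n) f.
  by apply: measurable_funS mf => // x /I0; rewrite /= in_itv /= andbT.
rewrite -UI.
pose mu : {measure set (measurableTypeR R) -> \bar R} := @lebesgue_measure R.
have := @ge0_nondecreasing_set_cvg_integral _ (measurableTypeR R) _ I (EFin \o f) mu ndI mI.
have mEf i : measurable_fun (I i) (EFin \o f) by apply/measurable_EFinP.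
move=> /(_ mEf) H.
have f0 i x : I i x -> (0 <= (EFin \o f) x)%E.
  by move=> /I0 /fF' /andP[+ _]; rewrite lee_fin.
have {}H := H f0.
apply: (cvge_to_le H); near=> n.
have cF'I : {within I n, continuous F'}.
  apply: continuous_in_subspaceT => x; rewrite inE => /I0; exact: cF'.
apply: (@le_trans _ _ (\int[@lebesgue_measure R]_(x in I n) (F' x)%:E)%E).
  apply: ge0_le_integral; first exact: mI.
  - exact: f0.
  - exact: mEf.
  - apply/measurable_EFinP; exact: subspace_continuous_measurable_fun.
  - by move=> x /I0 /fF' /andP[_]; rewrite lee_fin.
have cF x : 0 < x -> {for x, continuous F}.
  move=> x0; apply: differentiable_continuous; apply/derivable1_diffP.
  exact: (@ex_derive _ _ _ _ _ _ _ (dF x x0)).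
rewrite (@continuous_FTC2 _ F' F) //.
- rewrite -EFinB lee_fin.
  have := FM _ (n2 n); have : 0 < n.+2%:R :> R by rewrite ltr0n.
  move=> /FM; rewrite !ler_norml => /andP[? ?] /andP[? ?]; lra.
- by rewrite invf_plt ?posrE ?ltr0n // (@lt_trans _ _ 1) // ?invf_lt1 ?ltr0n // ltr1n.
- split => [x||].
  + rewrite in_itv /= => /andP[h _].
    exact: (@ex_derive _ _ _ _ _ _ _ (dF x (lt_trans (n2 n) h))).
  + apply: cvg_at_right_filter; exact: cF.
  + apply: cvg_at_left_filter; apply: cF; by rewrite ltr0n.
- move=> x; rewrite in_itv /= => /andP[h _].
  by rewrite derive1E; exact: (@derive_val _ _ _ _ _ _ _ (dF x (lt_trans (n2 n) h))).
Unshelve. all: by end_near. Qed.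

(** The majorant is K times the derivative of -1 / (1 + x^t), a bounded function: a single primitive
    handles the singularity at 0 and the tail at infinity. *)
Lemma Gamma_integrand_le (R : realType) (t : R) : 0 < t ->
  exists2 K : R, 0 < K & forall x : R, 0 < x ->
    x `^ (t - 1) * expR (- x) <= K * (t * x `^ (t - 1) / (1 + x `^ t) ^+ 2).
Proof.
move=> t0; pose k := (Num.truncn t).+1.
pose K := 4 + 2 * ((k * 2)`!)%:R : R.
have K0 : 0 < K by rewrite ltr_pwDl // mulr_ge0.
exists (K / t); first by rewrite divr_gt0.
move=> x x0.
have xt0 : 0 <= x `^ t by exact: powR_ge0.
have D0 : 0 < (1 + x `^ t) ^+ 2 by rewrite exprn_gt0 // ltr_pwDl.
rewrite -[t * _ / _]mulrA mulrA divfK ?gt_eqF // [K * _]mulrC -[X in _ <= X]mulrA.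
rewrite ler_wpM2l ?powR_ge0 // mulrC ler_pdivlMr // expRN mulrC ler_pdivrMr ?expR_gt0 //.
have xt : (x `^ t) ^+ 2 <= 1 + ((k * 2)`!)%:R * expR x.
  have kt : t <= k%:R by exact/ltW/truncnS_gt.
  have [x1|/ltW x1] := leP x 1.
    apply: le_trans (_ : 1 <= _); last by rewrite lerDl mulr_ge0 ?expR_ge0.
    rewrite exprn_ile1 //; have := @ger_powR _ x; rewrite x0 x1.
    by move=> /(_ isT _ _ (ltW t0)); rewrite powRr0.
  apply: (@le_trans _ _ (x ^+ (k * 2))).
    rewrite exprM lerXn2r ?nnegrE ?exprn_ge0 ?(ltW x0) //.
    by rewrite -powR_mulrn ?(ltW x0) // ler_powR.
  apply: ler_wpDl => //; rewrite mulrC -ler_pdivrMr ?ltr0n ?fact_gt0 //.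
  apply: le_trans (series_exp_le_expR (k * 2).+1 (ltW x0)).
  rewrite big_nat_recr //= lerDr sumr_ge0 // => i _.
  by rewrite divr_ge0 // exprn_ge0 // ltW.
have e1 : 1 <= expR x by rewrite -expR0 ler_expR ltW.
rewrite /K; move: ((k * 2)`!)%:R (x `^ t) (expR x) xt xt0 e1 => A y E xt xt0 e1.
by nra.
Qed.

Lemma Gamma_integral_lty (R : realType) (t : R) : 0 < t ->
  (\int[@lebesgue_measure R]_(x in [set` `]0, +oo[%R])
     (x `^ (t - 1) * expR (- x))%:E < +oo)%E.
Proof.
move=> t0; have [K K0 KP] := Gamma_integrand_le t0.
pose F (x : R) := - K * (1 + x `^ t)^-1.
have D0 x : 0 < 1 + x `^ t by rewrite ltr_pwDl // powR_ge0.
have dpow (p x : R) : 0 < x -> is_derive x (1:R) (fun x => x `^ p) (p * x `^ (p - 1)).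
  move=> x0; apply: DeriveDef; first by apply: derivable_powR; rewrite in_itv /= x0.
  by rewrite -derive1E powR_derive1 // in_itv /= x0.
have cpow (p x : R) : 0 < x -> {for x, continuous (fun x : R => x `^ p)}.
  move=> x0; apply: differentiable_continuous; apply/derivable1_diffP.
  exact: (@ex_derive _ _ _ _ _ _ _ (dpow p x x0)).
apply: le_lt_trans (@ge0_integral_0y_le R _ F
  (fun x => K * (t * x `^ (t - 1) / (1 + x `^ t) ^+ 2)) K _ _ _ _ _) _.
- apply: measurable_funTS; apply: measurable_funM; first exact: measurable_powR.
  by apply: measurableT_comp => //; exact: measurable_funN.
- by move=> x x0; rewrite KP // mulr_ge0 ?powR_ge0 ?expR_ge0.
- move=> x x0.
  have d1 : is_derive x (1:R) (fun x => 1 + x `^ t) (0 + t * x `^ (t - 1)).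
    by apply: is_deriveD; exact: dpow.
  have d2 := @is_deriveV _ (fun x => 1 + x `^ t) x _ 1 (lt0r_neq0 (D0 x)) d1.
  apply: (is_derive_eq (@is_deriveZ _ _ _ _ (- K) _ _ _ d2)).
  rewrite /GRing.scale /= add0r; ring.
- move=> x x0; apply: cvgMr; apply: cvgM.
    by apply: cvgMr; exact: cpow.
  apply: cvgV; first by rewrite expf_neq0 // gt_eqF.
  apply: (@continuous_comp _ _ _ (fun x => 1 + x `^ t) (fun y => y ^+ 2)); last first.
    exact: exprn_continuous.
  by apply: cvgD; [exact: cvg_cst|exact: cpow].
- move=> x x0; rewrite /F normrM normrN (gtr0_norm K0) ger0_norm ?invr_ge0 ?(ltW (D0 x)) //.
  by rewrite ler_piMr ?(ltW K0) // invf_le1 // lerDl powR_ge0.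
- exact: ltry.
Qed.

Section GammaDensity.
Variable R : realType.
Local Notation RT := (measurableTypeR R).
Local Notation mu := (@lebesgue_measure R).
Implicit Types t x : R.

Lemma measurable_gamma_kernel :
  measurable_fun [set: RT * RT] (fun z : RT * RT => (z.2 `^ (z.1 - 1) * expR (- z.2) : RT)).
Proof.
apply: measurable_funM; last first.
  by apply: measurableT_comp => //; apply: measurableT_comp => //; exact: measurable_snd.
rewrite /powR; apply: measurable_fun_ifT.
- by apply: (measurable_fun_eqr measurable_snd); exact: measurable_cst.
- have -> : (fun z : RT * RT => (z.1 - 1 == 0)%:R : RT) =
      (fun z => if z.1 - 1 == 0 then (1 : RT) else 0).
    by apply/funext => z; case: eqP.
  apply: measurable_fun_ifT => //; apply: measurable_fun_eqr => //.
  by apply: measurable_funB => //; exact: measurable_fst.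
- apply: measurableT_comp => //; apply: measurable_funM.
    by apply: measurable_funB => //; exact: measurable_fst.
  apply: measurableT_comp; [exact: measurable_ln|exact: measurable_snd].
Qed.

Lemma Gamma_fin_num t : 0 < t ->
  (\int[mu]_(x in [set` `]0, +oo[%R]) (x `^ (t - 1) * expR (- x))%:E = (Gamma t)%:E)%E.
Proof.
move=> t0; rewrite /Gamma /Rintegral fineK // ge0_fin_numE.
  exact: Gamma_integral_lty.
by apply: integral_ge0 => x _; rewrite lee_fin mulr_ge0 ?powR_ge0 ?expR_ge0.
Qed.

(** On [1, 2], x^(t-1) >= 1/x >= 1/2 and e^-x >= e^-2. The bound is uniform in [t], and so bounds 1
    / Gamma on the whole of [a, b]. *)
Lemma Gamma_ge t : 0 < t -> expR (- 2) / 2 <= Gamma t.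
Proof.
move=> t0; rewrite -lee_fin -Gamma_fin_num //.
have mf D : measurable D -> measurable_fun (D : set RT) (fun x => (x `^ (t - 1) * expR (- x))%:E).
  move=> mD; apply/measurable_EFinP; apply: measurable_funTS.
  apply: measurable_funM; first exact: measurable_powR.
  by apply: measurableT_comp => //; exact: measurable_funN.
have m12 : measurable (`[1, 2]%classic : set RT) by exact: measurable_itv.
apply: (@le_trans _ _ (\int[mu]_(x in `[1%R, 2%R]) (x `^ (t - 1) * expR (- x))%:E)%E); last first.
  apply: ge0_subset_integral => //.
  - exact: mf.
  - by move=> x _; rewrite lee_fin mulr_ge0 ?powR_ge0 ?expR_ge0.
  - by move=> x /=; rewrite !in_itv /= andbT => /andP[+ _]; apply: lt_le_trans.
apply: (@le_trans _ _ (\int[mu]_(x in `[1%R, 2%R]) (expR (- 2) / 2)%:E)%E).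
  have mu12 : mu `[1%R, 2%R] = 1%:E.
    by rewrite lebesgue_measure_itv /= lte_fin ltr1n -EFinB; congr EFin; lra.
  by rewrite integral_cst // [X in (_ * X)%E](_ : _ = 1%:E) // mule1.
apply: ge0_le_integral; first exact: m12.
- by move=> x _; rewrite lee_fin mulr_ge0 ?expR_ge0.
- exact: measurable_cst.
- exact: mf.
- move=> x; rewrite /= in_itv /= => /andP[x1 x2]; rewrite lee_fin mulrC.
  apply: ler_pM; rewrite ?expR_ge0 ?invr_ge0 //; last by rewrite ler_expR lerN2.
  apply: (@le_trans _ _ (x `^ (-1))); last by rewrite ler_powR //; lra.
  by rewrite powR_inv1 ?(le_trans _ x1) // lef_pV2 ?posrE ?(lt_le_trans _ x1).
Qed.

Lemma Gamma_gt0 t : 0 < t -> 0 < Gamma t.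
Proof. by move=> /Gamma_ge; apply: lt_le_trans; rewrite divr_gt0 // expR_gt0. Qed.

(** For x < 1, x^(t-1) is at most x^(a-1), and for x >= 1 at most x^(b-1). *)
Lemma Gamma_le (a b t : R) : 0 < a -> a <= t <= b -> Gamma t <= Gamma a + Gamma b.
Proof.
move=> a0 /andP[at_ tb]; have t0 := lt_le_trans a0 at_; have b0 := lt_le_trans t0 tb.
rewrite -lee_fin EFinD -!Gamma_fin_num //.
have mf s : measurable_fun (`]0, +oo[%classic : set RT) (fun x => (x `^ (s - 1) * expR (- x))%:E).
  apply/measurable_EFinP; apply: measurable_funTS.
  apply: measurable_funM; first exact: measurable_powR.
  by apply: measurableT_comp => //; exact: measurable_funN.
have f0 s x : (0 <= (x `^ (s - 1) * expR (- x))%:E)%E.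
  by rewrite lee_fin mulr_ge0 ?powR_ge0 ?expR_ge0.
rewrite -ge0_integralD //.
apply: ge0_le_integral => //; first exact: emeasurable_funD.
move=> x; rewrite /= in_itv /= andbT => x0.
rewrite -EFinD lee_fin -mulrDl ler_wpM2r ?expR_ge0 //.
have [x1|/ltW x1] := leP x 1.
  apply: ler_wpDr; first exact: powR_ge0.
  by have := @ger_powR _ x; rewrite x0 x1 => /(_ isT); apply; rewrite lerB.
by apply: ler_wpDl; [exact: powR_ge0|rewrite ler_powR // lerB].
Qed.

Lemma measurable_Gamma : measurable_fun [set: RT] (@Gamma R : RT -> RT).
Proof.
rewrite /Gamma /Rintegral.
apply: measurableT_comp => //.
under eq_fun do rewrite integral_mkcond.
have mf : measurable_fun [set: RT * RT] (fun z : RT * RT =>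
    ((fun x : RT => (x `^ (z.1 - 1) * expR (- x))%:E) \_ (`]0, +oo[%classic : set RT)) z.2).
  have -> : (fun z : RT * RT =>
      ((fun x : RT => (x `^ (z.1 - 1) * expR (- x))%:E) \_ (`]0, +oo[%classic : set RT)) z.2) =
    (fun z : RT * RT => if (0 < z.2)%R then (z.2 `^ (z.1 - 1) * expR (- z.2))%:E else 0%E).
    by apply/funext => z; rewrite patchE mem_setE in_itv /= andbT.
  apply: measurable_fun_ifT => //.
    by apply: measurable_fun_ltr => //; exact: measurable_snd.
  by apply/measurable_EFinP; exact: measurable_gamma_kernel.
apply: (@measurable_fun_fubini_tonelli_F _ _ RT RT R mu _ mf) => z.
by rewrite patchE; case: ifP => // _; rewrite lee_fin mulr_ge0 ?powR_ge0 ?expR_ge0.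
Qed.

Lemma measurable_Gamma_inv : measurable_fun [set: RT] (fun t : RT => (Gamma t)^-1 : RT).
Proof.
have -> : (fun t : RT => (Gamma t)^-1) = (fun t => Gamma t `^ (-1)).
  apply/funext => t; rewrite powR_inv1 //; apply: Rintegral_ge0 => x _.
  by rewrite mulr_ge0 ?powR_ge0 ?expR_ge0.
exact: (measurableT_comp (measurable_powR (-1)) measurable_Gamma).
Qed.

Lemma gamma_density_ge0 t x : 0 < t -> 0 <= gamma_density t x.
Proof.
move=> t0; rewrite /gamma_density; case: ifP => // _.
by rewrite divr_ge0 ?(ltW (Gamma_gt0 t0)) // mulr_ge0 ?powR_ge0 ?expR_ge0.
Qed.

Lemma measurable_gamma_density :
  measurable_fun [set: RT * RT] (fun z : RT * RT => gamma_density z.1 z.2 : RT).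
Proof.
rewrite /gamma_density; apply: measurable_fun_ifT => //.
  by apply: measurable_fun_ler => //; exact: measurable_snd.
apply: measurable_funM; first exact: measurable_gamma_kernel.
exact: (measurableT_comp measurable_Gamma_inv measurable_fst).
Qed.

Lemma integral_gamma_density t : 0 < t ->
  (\int[mu]_x (gamma_density t x)%:E = 1)%E.
Proof.
move=> t0; have G0 := Gamma_gt0 t0.
have mg : measurable_fun [set: RT] (fun x : RT => gamma_density t x : RT).
  exact: (measurableT_comp measurable_gamma_density (pair1_measurable t)).
transitivity (\int[mu]_(x in [set` `]0, +oo[%R]) (gamma_density t x)%:E)%E.
  rewrite [RHS]integral_mkcond; apply: ge0_ae_eq_integral => //.
  - exact/measurable_EFinP.
  - apply/(measurable_restrictT _ _).1; first exact: measurable_itv.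
    by apply: measurable_funTS; exact/measurable_EFinP.
  - by move=> x _; rewrite lee_fin gamma_density_ge0.
  - by move=> x _; rewrite patchE; case: ifP => // _; rewrite lee_fin gamma_density_ge0.
  (* The density lives on x >= 0 and the integral is taken on x > 0; at the origin the density need
     not vanish, as for t = 1. *)
  exists [set 0 : R]; split => //; first exact: lebesgue_measure_set1.
  move=> x /= /not_implyP[_]; rewrite patchE mem_setE in_itv /= andbT.
  case: ltgtP => // x0 [].
  by rewrite /gamma_density leNgt x0.
transitivity ((Gamma t)^-1%:E *
    \int[mu]_(x in [set` `]0, +oo[%R]) (x `^ (t - 1) * expR (- x))%:E)%E.
  rewrite -ge0_integralZl_EFin //.
  - apply: eq_integral => x; rewrite inE /= in_itv /= andbT => x0.
    by rewrite /gamma_density (ltW x0) -EFinM mulrC.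
  - by move=> x _; rewrite lee_fin mulr_ge0 ?powR_ge0 ?expR_ge0.
  - apply/measurable_EFinP; apply: measurable_funTS.
    apply: measurable_funM; first exact: measurable_powR.
    by apply: measurableT_comp => //; exact: measurable_funN.
  - by rewrite invr_ge0 ltW.
by rewrite Gamma_fin_num // -EFinM mulVf // gt_eqF.
Qed.

End GammaDensity.

(** * Integrals of bounded functions on [a, b], and mixtures *)

Section IntervalIntegrals.
Variables (R : realType) (a b : R).
Hypothesis ab : a <= b.
Local Notation RT := (measurableTypeR R).
Local Notation mu := (@lebesgue_measure R).
Local Notation I := (`[a, b]%classic : set RT).
Implicit Types f g : RT -> R.

Lemma measurable_segment : measurable I.
Proof. exact: measurable_itv. Qed.

Lemma lebesgue_measure_segment : mu `[a, b] = (b - a)%:E.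
Proof.
rewrite lebesgue_measure_itv /= lte_fin.
move: ab; rewrite le_eqVlt => /predU1P[->|->]; last by rewrite -EFinB.
by rewrite ltxx subrr.
Qed.

Lemma bounded_integrable_segment f B : measurable_fun I f ->
  (forall t, t \in `[a, b] -> `|f t| <= B) -> mu.-integrable I (EFin \o f).
Proof.
move=> mf fB; apply: measurable_bounded_integrable => //.
- by rewrite [X in (X < _)%E](_ : _ = (b - a)%:E) ?ltry //; exact: lebesgue_measure_segment.
- exists B; split; first exact: num_real.
  by move=> M BM t It /=; apply: le_trans (fB _ It) (ltW BM).
Qed.

Lemma Rintegral_segment_le f B : measurable_fun I f ->
  (forall t, t \in `[a, b] -> `|f t| <= B) ->
  `|\int[mu]_(t in `[a, b]) f t| <= B * (b - a).
Proof.
move=> mf fB; apply: le_trans (le_normr_Rintegral _ (bounded_integrable_segment mf fB)) _.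
  exact: measurable_segment.
apply: (@le_trans _ _ (\int[mu]_(t in `[a, b]) B)).
  apply: le_Rintegral; first exact: measurable_segment.
  - apply: (@bounded_integrable_segment _ B); first exact: measurableT_comp.
    by move=> t /fB; rewrite normr_id.
  - by apply: (@bounded_integrable_segment _ `|B|) => //; exact: measurable_cst.
  - by move=> t; exact: fB.
rewrite Rintegral_cst; last exact: measurable_segment.
by rewrite [X in _ * X](_ : _ = b - a) //; rewrite -[RHS]/(fine (b - a)%:E) -lebesgue_measure_segment.
Qed.

Lemma Rintegral_segment_sum (J : Type) (s : seq J) (f : J -> RT -> RT) (B : J -> R) :
  (forall k, measurable_fun I (f k)) ->
  (forall k t, t \in `[a, b] -> `|f k t| <= B k) ->
  \int[mu]_(t in `[a, b]) (\sum_(k <- s) f k t) =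
  \sum_(k <- s) \int[mu]_(t in `[a, b]) f k t.
Proof.
move=> mf fB; elim: s => [|k s IH].
  under eq_Rintegral do rewrite big_nil.
  by rewrite big_nil Rintegral_cst ?mul0r //; exact: measurable_segment.
under eq_Rintegral do rewrite big_cons.
rewrite RintegralD; first by rewrite big_cons IH.
- exact: measurable_segment.
- exact: (bounded_integrable_segment (mf k) (fB k)).
- apply: (@bounded_integrable_segment _ (\sum_(k <- s) B k)).
    exact: measurable_sum.
  move=> t It; apply: le_trans (ler_norm_sum _ _ _) _.
  by apply: ler_sum => i _; exact: fB.
Qed.

End IntervalIntegrals.

Section GammaMixture.
Variables (R : realType) (a b : R).
Hypotheses (a0 : 0 < a) (ab : a < b).
Local Notation RT := (measurableTypeR R).
Local Notation mu := (@lebesgue_measure R).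
Local Notation I := (`[a, b]%classic : set RT).
Implicit Types F G : RT -> RT.

Let t0_gt0 t : t \in `[a, b] -> 0 < t.
Proof. by rewrite in_itv /= => /andP[+ _]; apply: lt_le_trans. Qed.

(** The counterpart of [mixture_density] for functions instead of L2 classes: mass and domination
    are computed on explicit functions, then transferred to any representative equal to them almost
    everywhere. *)
Definition gamma_mixture F x := \int[mu]_(t in `[a, b]) (F t * gamma_density t x).

Lemma gamma_density_bounded x :
  exists B, forall t, t \in `[a, b] -> `|gamma_density t x| <= B.
Proof.
have e2 : 0 < expR (- 2) / 2 :> R by rewrite divr_gt0 // expR_gt0.
(* The summand 1 covers x = 0, where x^(t-1) is 1 for t = 1 and 0 otherwise. *)
exists ((1 + x `^ (a - 1) + x `^ (b - 1)) * expR (- x) / (expR (- 2) / 2)) => t It.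
have t0 := t0_gt0 It; rewrite ger0_norm ?gamma_density_ge0 //.
have B0 : 0 <= (1 + x `^ (a - 1) + x `^ (b - 1)) * expR (- x).
  by rewrite mulr_ge0 ?expR_ge0 // !addr_ge0 ?powR_ge0.
rewrite /gamma_density; case: ifP => [x0|_]; last by rewrite divr_ge0 // ltW.
apply: ler_pM; rewrite ?mulr_ge0 ?powR_ge0 ?expR_ge0 ?invr_ge0 ?(ltW (Gamma_gt0 t0)) //.
  rewrite ler_wpM2r ?expR_ge0 //.
  move: x0; rewrite le_eqVlt => /predU1P[<-|x0].
    rewrite /powR eqxx; apply: (@le_trans _ _ 1); first by case: eqP.
    by rewrite -addrA lerDl addr_ge0.
  have [pa pb] := (powR_ge0 x (a - 1), powR_ge0 x (b - 1)).
  move: It; rewrite in_itv /= => /andP[at_ tb].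
  have [x1|/ltW x1] := leP x 1.
    have : x `^ (t - 1) <= x `^ (a - 1).
      by have := @ger_powR _ x; rewrite x0 x1 => /(_ isT); apply; rewrite lerB.
    by move=> ?; lra.
  have : x `^ (t - 1) <= x `^ (b - 1) by rewrite ler_powR // lerB.
  by move=> ?; lra.
by rewrite lef_pV2 ?posrE ?Gamma_gt0 // Gamma_ge.
Qed.

Lemma measurable_gamma_density1 x D :
  measurable_fun (D : set RT) (fun t : RT => gamma_density t x : RT).
Proof.
apply: measurable_funTS.
exact: (measurableT_comp (@measurable_gamma_density R) (pair2_measurable x)).
Qed.

Lemma gamma_mixture_integrable F A x : measurable_fun I F ->
  (forall t, t \in `[a, b] -> `|F t| <= A) ->
  mu.-integrable I (EFin \o (fun t => F t * gamma_density t x)).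
Proof.
move=> mF FA; have [B HB] := gamma_density_bounded x.
apply: (bounded_integrable_segment (ltW ab) (B := A * B)).
  by apply: measurable_funM => //; exact: measurable_gamma_density1.
by move=> t It; rewrite normrM ler_pM // ?FA ?HB.
Qed.

Lemma gamma_mixture_EFin F A x : measurable_fun I F ->
  (forall t, t \in `[a, b] -> `|F t| <= A) ->
  (\int[mu]_(t in `[a, b]) (F t * gamma_density t x)%:E = (gamma_mixture F x)%:E)%E.
Proof.
move=> mF FA; rewrite /gamma_mixture /Rintegral fineK //.
apply: integrable_fin_num; first exact: measurable_segment.
exact: gamma_mixture_integrable FA.
Qed.

(** Extending the integrand by zero off [a, b] makes it a nonnegative function on the whole plane,
    in the form to which Tonelli's theorem applies. *)
Let patched F (z : RT * RT) : \bar R :=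
  (((fun t : RT => (F t * gamma_density t z.2)%:E) \_ I) z.1)%E.

Let measurable_patched F : measurable_fun setT F -> measurable_fun setT (patched F).
Proof.
move=> mF; rewrite /patched.
have -> : (fun z : RT * RT => ((fun t : RT => (F t * gamma_density t z.2)%:E) \_ I) z.1) =
  (fun z => if (a <= z.1 <= b) then (F z.1 * gamma_density z.1 z.2)%:E else 0%E).
  by apply/funext => z; rewrite patchE mem_setE in_itv.
apply: measurable_fun_ifT => //.
  apply: measurable_and => /=.
    by apply: measurable_fun_ler => //; exact: measurable_fst.
  by apply: measurable_fun_ler => //; exact: measurable_fst.
apply/measurable_EFinP; apply: measurable_funM; last exact: measurable_gamma_density.
exact: (measurableT_comp mF measurable_fst).
Qed.

Let patched_ge0 F z : (forall t, t \in `[a, b] -> 0 <= F t) -> (0 <= patched F z)%E.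
Proof.
move=> F0; rewrite /patched patchE mem_setE; case: ifP => // It.
by rewrite lee_fin mulr_ge0 ?F0 // gamma_density_ge0 // t0_gt0.
Qed.

Lemma gamma_mixture_ge0 F x : (forall t, t \in `[a, b] -> 0 <= F t) ->
  0 <= gamma_mixture F x.
Proof.
move=> F0; apply: Rintegral_ge0 => t It.
by rewrite mulr_ge0 ?F0 // gamma_density_ge0 // t0_gt0.
Qed.

Lemma measurable_gamma_mixture F : measurable_fun setT F ->
  (forall t, t \in `[a, b] -> 0 <= F t) ->
  measurable_fun setT (gamma_mixture F : RT -> RT).
Proof.
move=> mF F0; rewrite /gamma_mixture /Rintegral; apply: measurableT_comp => //.
under eq_fun do rewrite integral_mkcond.
apply: (@measurable_fun_fubini_tonelli_G _ _ RT RT R mu (patched F)).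
  exact: measurable_patched.
by move=> z; exact: patched_ge0.
Qed.

Lemma integral_gamma_mixture F A : measurable_fun setT F ->
  (forall t, t \in `[a, b] -> 0 <= F t <= A) ->
  (\int[mu]_x (gamma_mixture F x)%:E = \int[mu]_(t in `[a, b]) (F t)%:E)%E.
Proof.
move=> mF FA; have F0 t : t \in `[a, b] -> 0 <= F t by move=> /FA /andP[].
have FA' t : t \in `[a, b] -> `|F t| <= A.
  by move=> It; rewrite ger0_norm ?F0 //; case/andP: (FA t It).
transitivity (\int[mu]_x \int[mu]_t patched F (t, x))%E.
  apply: eq_integral => x _; rewrite -(gamma_mixture_EFin _ _ FA').
    by rewrite integral_mkcond.
  exact: measurable_funTS.
rewrite -(@fubini_tonelli _ _ RT RT R mu mu (patched F)); last 2 first.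
- exact: measurable_patched.
- by move=> z; exact: patched_ge0.
rewrite [RHS]integral_mkcond; apply: eq_integral => t _.
rewrite /patched /= patchE mem_setE; case: ifP => It.
  under eq_integral do rewrite patchE mem_setE It EFinM.
  rewrite ge0_integralZl_EFin ?F0 //.
  - by rewrite integral_gamma_density ?mule1 // t0_gt0.
  - by move=> x _; rewrite lee_fin gamma_density_ge0 // t0_gt0.
  - apply/measurable_EFinP.
    exact: (measurableT_comp (@measurable_gamma_density R) (pair1_measurable t)).
by under eq_integral do rewrite patchE mem_setE It; rewrite integral0.
Qed.

End GammaMixture.

(** * Perturbed mixtures dominated by the uniform mixture *)

Section MixtureDomination.
Variables (R : realType) (a b : R).
Hypotheses (a0 : 0 < a) (ab : a < b).
Local Notation RT := (measurableTypeR R).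
Local Notation mu := (@lebesgue_measure R).
Local Notation I := (`[a, b]%classic : set RT).
Local Notation mid := ((a + b) / 2).
Local Notation E L := (expR ((b - a) / 4 * `|L|)).

Let It0 t : t \in `[a, b] -> 0 < t.
Proof. by rewrite in_itv /= => /andP[+ _]; apply: lt_le_trans. Qed.

Let dist_mid t : t \in `[a, b] -> `|t - mid| <= b - a.
Proof.
by rewrite in_itv /= ler_norml => /andP[? ?]; apply/andP; split; lra.
Qed.

Lemma measurable_moment_weight k :
  measurable_fun setT (fun t : RT => (Gamma t)^-1 * (t - mid) ^+ k : RT).
Proof.
apply: measurable_funM; first exact: measurable_Gamma_inv.
by apply: measurable_funX; exact: measurable_funB.
Qed.

Lemma moment_weight_bounded k :
  exists B, forall t, t \in `[a, b] -> `|(Gamma t)^-1 * (t - mid) ^+ k| <= B.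
Proof.
exists ((expR (-2) / 2)^-1 * (b - a) ^+ k) => t It; have t0 := It0 It.
rewrite normrM; apply: ler_pM => //.
  rewrite normfV gtr0_norm ?Gamma_gt0 //.
  by rewrite lef_pV2 ?posrE ?Gamma_gt0 ?Gamma_ge // divr_gt0 // expR_gt0.
rewrite normrX lerXn2r ?nnegrE ?subr_ge0 ?(ltW ab) //.
exact: dist_mid.
Qed.

(** This factorization is the reason for weighting the moments by 1 / Gamma: apart from that factor,
    the dependence on [t] is the exponential of (t - mid) ln x, whose Taylor polynomials in t - mid
    the moments can cancel. *)
Lemma gamma_densityE t x : 0 < x ->
  gamma_density t x =
  x `^ (mid - 1) * expR (- x) * (expR ((t - mid) * ln x) / Gamma t).
Proof.
move=> x0; rewrite /gamma_density (ltW x0) /powR gt_eqF //.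
have -> : (t - 1) * ln x = (mid - 1) * ln x + (t - mid) * ln x by ring.
by rewrite expRD; ring.
Qed.

(** The outer quarter of [a, b] on the side given by the sign of [L]; there (t - mid) L >= |L| (b -
    a) / 4. *)
Let Q (L : R) : set RT :=
  if 0 <= L then `[mid + (b - a) / 4, b]%classic else `[a, mid - (b - a) / 4]%classic.

Let QI L : Q L `<=` I.
Proof.
move=> t; rewrite /Q; case: ifP => _; rewrite /= !in_itv /= => /andP[? ?];
  by apply/andP; split; lra.
Qed.

Let mQ L : measurable (Q L).
Proof. by rewrite /Q; case: ifP => _; exact: measurable_itv. Qed.

Let muQ L : mu (Q L) = ((b - a) / 4)%:E.
Proof.
rewrite /Q; case: ifP => _; rewrite lebesgue_measure_itv /= lte_fin ifT.
- by rewrite -EFinB; congr EFin; lra.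
- by move: ab => ?; lra.
- by rewrite -EFinB; congr EFin; lra.
- by move: ab => ?; lra.
Qed.

(** Integrating over the outer quarter [Q (ln x)] alone yields both extreme exponents mid + (b -
    a)/4 and mid - (b - a)/4, according to whether x >= 1 or x < 1. *)
Lemma gamma_mixture_cst_ge x : 0 < x ->
  x `^ (mid - 1) * expR (- x) * (E (ln x) / (Gamma a + Gamma b)) * ((b - a) / 4)
  <= gamma_mixture a b (fun=> 1) x.
Proof.
move=> x0; set L := ln x; set p := x `^ _ * _.
have p0 : 0 <= p by rewrite mulr_ge0 ?powR_ge0 ?expR_ge0.
have b0 : 0 < b := lt_trans a0 ab.
have G0 : 0 < Gamma a + Gamma b by rewrite addr_gt0 ?Gamma_gt0.
set c := p * _.
have c0 : 0 <= c by rewrite mulr_ge0 // divr_ge0 ?expR_ge0 // ltW.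
have mQ1 : measurable_fun I (fun t : RT => c * \1_(Q L) t : RT).
  apply: measurable_funM => //; exact: measurable_indic.
have -> : c * ((b - a) / 4) = \int[mu]_(t in `[a, b]) (c * \1_(Q L) t).
  rewrite /Rintegral; under eq_integral do rewrite EFinM.
  rewrite ge0_integralZl_EFin //.
  - rewrite integral_indic // setIidl; last exact: QI.
    by rewrite [X in (_ * X)%E](_ : _ = ((b - a) / 4)%:E) //; exact: muQ.
  - by apply/measurable_EFinP; exact: measurable_indic.
apply: le_Rintegral; first exact: measurable_segment.
- apply: (bounded_integrable_segment (ltW ab) (B := c)) => // t It.
  rewrite /= indicE; case: (_ \in _); rewrite /= ?mulr1 ?mulr0 ?normr0 ?ger0_norm //.
- apply: (gamma_mixture_integrable a0 ab (A := 1)) => // t _.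
  by rewrite normr1.
move=> t It; rewrite mul1r indicE; have [/set_mem Qt|_] := boolP (t \in Q L); last first.
  by rewrite mulr0 gamma_density_ge0 // It0.
rewrite mulr1 gamma_densityE // /c ler_wpM2l //.
apply: ler_pM; rewrite ?expR_ge0 ?invr_ge0 ?(ltW G0) //; last first.
  by rewrite lef_pV2 ?posrE //; [exact: Gamma_le|exact/Gamma_gt0/It0].
rewrite ler_expR -/L.
move: Qt; rewrite /Q; case: ifP => L0; rewrite /= in_itv /= => /andP[t1 t2].
  by rewrite ger0_norm // ler_wpM2r // lerBrDl.
have {L0} : L < 0 by rewrite ltNge L0.
by move=> L0; rewrite ltr0_norm // mulrN -mulNr ler_wnM2r ?(ltW L0) // lerBlDl.
Qed.

(* [s] is the base of the geometric decay: the [m] vanishing moments of [G]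
   on a window of radius [(b - a) / (4 s)] cancel the Taylor polynomial of
   [expR ((t - mid) * ln x)], leaving the remainder [s^-m x^(+- (b - a) / 4)];
   the exponents [mid +- (b - a) / 4] are interior to [[a, b]], so that the
   uniform mixture dominates this remainder at every [x]. *)
Lemma gamma_mixture_small : exists2 K : R, 0 < K &
  forall (s A : R) m (G : RT -> RT), 1 <= s ->
    measurable_fun setT G -> (forall t, `|G t| <= A) ->
    (forall t, (b - a) / (4 * s) <= `|t - mid| -> G t = 0) ->
    (forall k, (k < m)%N ->
      \int[mu]_(t in `[a, b]) (G t / Gamma t * (t - mid) ^+ k) = 0) ->
    forall x, `|gamma_mixture a b G x|
      <= K * A * s ^- m * gamma_mixture a b (fun=> 1) x.
Proof.
have b0 : 0 < b := lt_trans a0 ab.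
have G0 : 0 < Gamma a + Gamma b by rewrite addr_gt0 ?Gamma_gt0.
pose g0 : R := expR (- 2) / 2.
have g00 : 0 < g0 by rewrite divr_gt0 // expR_gt0.
(* The ratio of the two estimates: the remainder carries (b - a) / g0, with 1 / g0 the bound on 1 /
   Gamma, and the lower bound on the uniform mixture carries (b - a) / (4 (Gamma a + Gamma b)). *)
exists (4 * (Gamma a + Gamma b) / g0); first by rewrite divr_gt0 // mulr_gt0.
move=> s A m G s1 mG GA Gsupp Gmom x.
have s0 : 0 < s by apply: lt_le_trans s1.
have A0 : 0 <= A by apply: le_trans (GA 0).
have K0 : 0 <= 4 * (Gamma a + Gamma b) / g0 by rewrite divr_ge0 // ?mulr_ge0 // ltW.
have rhs0 y : 0 <= 4 * (Gamma a + Gamma b) / g0 * A * s ^- m * gamma_mixture a b (fun=> 1) y.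
  rewrite mulr_ge0 ?gamma_mixture_ge0 // mulr_ge0 ?invr_ge0 ?exprn_ge0 ?(ltW s0) //.
  by rewrite mulr_ge0.
have [x0|x0|x0] := ltgtP 0 x; last 2 first.
- suff -> : gamma_mixture a b G x = 0 by rewrite normr0.
  rewrite /gamma_mixture; under eq_Rintegral do rewrite /gamma_density leNgt x0 /= mulr0.
  by rewrite Rintegral_cst ?mul0r //; exact: measurable_segment.
(* At x = 0 the density vanishes for every shape except t = 1, and this single shape is a null
   set. *)
- suff -> : gamma_mixture a b G x = 0 by rewrite normr0.
  transitivity (\int[mu]_(t in `[a, b]) (0 : R)); last first.
    by rewrite Rintegral_cst ?mul0r //; exact: measurable_segment.
  congr fine; apply: ae_eq_integral; first exact: measurable_segment.
  - apply/measurable_EFinP; apply: measurable_funM; first exact: measurable_funTS.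
    exact: measurable_gamma_density1.
  - exact: measurable_cst.
  exists [set 1 : R]; split => //; first exact: lebesgue_measure_set1.
  move=> t /= /not_implyP[_]; rewrite -x0 /gamma_density lexx /powR eqxx subr_eq0.
  by case: eqP => // _ []; rewrite !mul0r mulr0.
set L := ln x; set p := x `^ (mid - 1) * expR (- x).
have p0 : 0 <= p by rewrite mulr_ge0 ?powR_ge0 ?expR_ge0.
pose H (t : RT) : RT := G t / Gamma t.
have HA t : t \in `[a, b] -> `|H t| <= A / g0.
  move=> /It0 t0; rewrite normrM ler_pM // normfV gtr0_norm ?Gamma_gt0 //.
  by rewrite lef_pV2 ?posrE ?Gamma_gt0 // Gamma_ge.
pose S (t : RT) : RT := \sum_(k < m) ((t - mid) * L) ^+ k / k`!%:R.
pose f1 (t : RT) : RT := H t * (expR ((t - mid) * L) - S t).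
pose f2 k (t : RT) : RT := L ^+ k / k`!%:R * (H t * (t - mid) ^+ k).
have decomp t : G t * gamma_density t x = p * (f1 t + \sum_(k < m) f2 k t).
  rewrite gamma_densityE // -/p -/L /f1 /H.
  have -> : \sum_(k < m) f2 k t = H t * S t.
    rewrite /S mulr_sumr; apply: eq_bigr => k _; rewrite /f2 exprMn.
    by rewrite /H; ring.
  by rewrite /H; ring.
have mH : measurable_fun setT H.
  by apply: measurable_funM => //; exact: measurable_Gamma_inv.
have mmid : measurable_fun setT (fun t : RT => (t - mid) : RT).
  by apply: measurable_funB.
have mS : measurable_fun setT S.
  apply: measurable_sum => k; apply: measurable_funM => //.
  by apply: measurable_funX; apply: measurable_funM.
have mf1 : measurable_fun setT f1.
  apply: measurable_funM => //; apply: measurable_funB => //.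
  by apply: measurableT_comp => //; apply: measurable_funM.
have mf2 k : measurable_fun setT (f2 k).
  apply: measurable_funM => //; apply: measurable_funM => //.
  exact: measurable_funX.
(* Off the window [G] vanishes. Inside it, s |t - mid| <= (b - a)/4, so the exponential in the
   Taylor remainder is at most [E L], the same factor as in the lower bound on the uniform
   mixture. *)
have f1A t : t \in `[a, b] -> `|f1 t| <= A / g0 * (s ^- m * E L).
  move=> It; have [tm|tm] := leP ((b - a) / (4 * s)) `|t - mid|.
    rewrite /f1 /H Gsupp // !mul0r normr0 mulr_ge0 ?divr_ge0 ?(ltW g00) //.
    by rewrite mulr_ge0 ?expR_ge0 // invr_ge0 exprn_ge0 // ltW.
  rewrite normrM ler_pM ?HA //.
  rewrite /S; apply: le_trans (expR_taylor_remainder _ _ s1) _.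
  rewrite ler_wpM2l ?invr_ge0 ?exprn_ge0 ?(ltW s0) // ler_expR normrM mulrA.
  rewrite ler_wpM2r //; move/ltW: tm; rewrite ler_pdivlMr ?mulr_gt0 // => tm.
  by rewrite ler_pdivlMr // (_ : s * _ * 4 = `|t - mid| * (4 * s)) //; ring.
have f2B k : exists B, forall t, t \in `[a, b] -> `|f2 k t| <= B.
  exists (`|L ^+ k / k`!%:R| * (A / g0 * (b - a) ^+ k)) => t It.
  rewrite normrM ler_wpM2l // normrM ler_pM ?HA // normrX lerXn2r ?nnegrE //.
    by rewrite subr_ge0 ltW.
  exact: dist_mid.
have [B HB] := choice f2B.
have If1 : mu.-integrable I (EFin \o f1).
  by apply: (bounded_integrable_segment (ltW ab)) f1A; exact: measurable_funTS.
have If2 : mu.-integrable I (EFin \o (fun t => \sum_(k < m) f2 k t)).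
  apply: (bounded_integrable_segment (ltW ab) (B := \sum_(k < m) B k)).
    by apply: measurable_funTS; apply: measurable_sum => k; exact: mf2.
  move=> t It; apply: le_trans (ler_norm_sum _ _ _) _.
  by apply: ler_sum => k _; exact: HB.
have mI : measurable I by exact: measurable_segment.
have f20 : \int[mu]_(t in `[a, b]) (\sum_(k < m) f2 k t) = 0.
  rewrite (@Rintegral_segment_sum R a b (ltW ab) _ _ (fun k : 'I_m => f2 k) (fun k => B k)); last 2 first.
  - by move=> k; exact: (measurable_funTS (mf2 k)).
  - by move=> k t; exact: HB.
  rewrite big1 // => k _; rewrite /f2 RintegralZl ?Gmom ?mulr0 //.
  apply: (bounded_integrable_segment (ltW ab) (B := A / g0 * (b - a) ^+ k)).
    apply: measurable_funTS; apply: measurable_funM => //; exact: measurable_funX.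
  move=> t It; rewrite normrM ler_pM ?HA // normrX lerXn2r ?nnegrE //.
    by rewrite subr_ge0 ltW.
  exact: dist_mid.
have -> : gamma_mixture a b G x = p * \int[mu]_(t in `[a, b]) f1 t.
  rewrite /gamma_mixture; under eq_Rintegral do rewrite decomp.
  rewrite RintegralZl //; first by rewrite RintegralD // f20 addr0.
  exact: (integrableD mI If1 If2).
rewrite normrM (ger0_norm p0).
have := Rintegral_segment_le (ltW ab) (measurable_funTS mf1) f1A.
move=> /(ler_wpM2l p0) h; apply: le_trans h _.
apply: le_trans (ler_wpM2l _ (gamma_mixture_cst_ge x0)); last first.
  rewrite mulr_ge0 ?invr_ge0 ?exprn_ge0 ?(ltW s0) //.
  by rewrite mulr_ge0.
rewrite -/L -/p le_eqVlt; apply/orP; left; apply/eqP.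
by field; rewrite !gt_eqF // exprn_gt0.
Qed.

End MixtureDomination.

(** * Classes of square-integrable functions *)

Section LebesguePowerIntegrals.
Variable R : realType.
Local Notation RT := (measurableTypeR R).
Local Notation mu := (@lebesgue_measure R).

(** [lebesgue_power] is only typed as a measure, while Tonelli's theorem expects a bundled
    sigma-finite one; the bundle is rebuilt here from sigma-finiteness as a hypothesis. *)
Lemma integral_product_lebesgue d (T : measurableType d)
    (m : {measure set T -> \bar R}) (f : T * RT -> \bar R) :
  sigma_finite setT m -> measurable_fun setT f -> (forall z, 0 <= f z)%E ->
  (\int[m \x mu]_z f z = \int[m]_x \int[mu]_y f (x, y))%E.
Proof.
move=> sf mf f0.
pose sfin := isSFinite.Build _ _ _ _ (sfinite_measure_sigma_finite sf).
pose sigfin := isSigmaFinite.Build _ _ _ _ sf.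
pose m1 := HB.pack_for {sigma_finite_measure set T -> \bar R} (Measure.sort m) sfin sigfin.
have -> : m = m1 by exact: eq_measure.
exact: (@fubini_tonelli1 _ _ _ _ _ m1 mu f).
Qed.

(** Exhaustion by the cubes [-k, k]^n, whose preimage under [tuple_cons] is a product. *)
Lemma lebesgue_power_sigma_finite n : sigma_finite setT (lebesgue_power R n).
Proof.
pose B n k : set (n.-tuple RT) := \bigcap_(i in [set: 'I_n])
  ((fun t : n.-tuple RT => tnth t i) @^-1` `[- k%:R, k%:R]).
have mB m k : measurable (B m k).
  apply: fin_bigcap_measurable => // i _; rewrite -[_ @^-1` _]setTI.
  by apply: measurable_tnth => //; exact: measurable_itv.
exists (B n).
  apply/esym; rewrite -subTset => t _; pose S := \sum_(i < n) `|tnth t i|.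
  exists (Num.truncn S).+1 => // i _ /=; rewrite in_itv /= -ler_norml.
  apply: ltW; apply: le_lt_trans (truncnS_gt S).
  by rewrite /S (bigD1 i) //= lerDl sumr_ge0.
move=> k; split; first exact: mB.
elim: n => [|n IH]; first by rewrite /= diracE ltry.
rewrite /= /pushforward.
have -> : @tuple_cons R n @^-1` B n.+1 k = B n k `*` `[- k%:R, k%:R].
  apply/seteqP; split => [[t x] H|[t x] [/= H Hx] i _ /=].
    split; last by have := H ord0 I.
    by move=> i _; have := H (lift ord0 i) I; rewrite /= tnthS.
  by case: (unliftP ord0 i) => [j|] ->; rewrite ?tnthS //; exact: H.
rewrite product_measure1E //; last exact: mB.
apply: lte_mul_pinfty => //; first by rewrite ge0_fin_numE.
by rewrite [X in (X < _)%E]lebesgue_measure_itv /=; case: ifP => _; rewrite ?ltry // -EFinB ltry.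
Qed.

Lemma integral_lebesgue_power_prod (q : RT -> RT) n :
  measurable_fun setT q -> (forall x, 0 <= q x) ->
  (\int[mu]_x (q x)%:E = 1)%E ->
  (\int[lebesgue_power R n]_x (\prod_(i < n) q (tnth x i))%:E = 1)%E.
Proof.
move=> mq q0 q1.
have mprod k : measurable_fun setT (fun x : k.-tuple RT => \prod_(i < k) q (tnth x i) : RT).
  apply: measurable_prod => i _; apply: (measurableT_comp mq); exact: measurable_tnth.
have prod0 k (x : k.-tuple RT) : 0 <= \prod_(i < k) q (tnth x i).
  by apply: prodr_ge0.
elim: n => [|n IH].
  rewrite /= integral_dirac //; last by apply/measurable_EFinP; exact: mprod.
  by rewrite diracT mul1e big_ord0.
rewrite /= ge0_integral_pushforward //=; last 2 first.
- apply/measurable_EFinP; exact: mprod.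
- by move=> x _; rewrite lee_fin; exact: prod0.
rewrite preimage_setT.
transitivity (\int[lebesgue_power R n \x mu]_z ((q z.2)%:E * (\prod_(i < n) q (tnth z.1 i))%:E))%E.
  apply: eq_integral => z _.
  rewrite /= big_ord_recl -EFinM /tuple_cons; congr (_ * _)%:E.
  by apply: eq_bigr => i _; rewrite tnthS.
rewrite integral_product_lebesgue /=; last 3 first.
- exact: lebesgue_power_sigma_finite.
- apply: emeasurable_funM; apply/measurable_EFinP.
    exact: (measurableT_comp mq measurable_snd).
  exact: (measurableT_comp (mprod n) measurable_fst).
- by move=> z; rewrite -EFinM lee_fin mulr_ge0 //; exact: prod0.
rewrite -IH; apply: eq_integral => t _; rewrite /=.
rewrite ge0_integralZr //; first by rewrite q1 mul1e.
- exact/measurable_EFinP.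
- by move=> x _; rewrite lee_fin.
- by rewrite lee_fin; exact: prod0.
exact: measurable_tuple_cons.
Qed.

End LebesguePowerIntegrals.

(** * L2 norms, bounded representatives and class membership *)

Section L2Class.
Variables (R : realType) (a b : R).
Hypothesis ab : a < b.
Local Notation RT := (measurableTypeR R).
Local Notation mu := (@lebesgue_measure R).
Local Notation nu := (lebesgue_on a b).
Local Notation I := (`[a, b]%classic : set RT).
Implicit Types F G : RT -> RT.

Lemma lebesgue_onT : nu setT = (b - a)%:E.
Proof.
transitivity (mu (setT `&` I)) => //.
by rewrite setTI; apply: lebesgue_measure_segment; exact: ltW.
Qed.

Lemma ae_lebesgue_onP (P : set RT) :
  {ae nu, forall t, P t} <-> mu.-negligible (I `&` ~` P).
Proof.
have mI : measurable I by exact: measurable_segment.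
split=> [[N [mN N0 PN]]|[N [mN N0 PN]]].
  exists (N `&` I); split => //; first exact: measurableI.
  by move=> t [It nP]; split => //; exact: PN.
exists (N `|` ~` I); split; first by apply: measurableU => //; exact: measurableC.
- transitivity (mu ((N `|` ~` I) `&` I)) => //.
  rewrite setIUl setICl setU0; apply/eqP; rewrite eq_le measure_ge0 andbT -N0.
  by apply: le_measure; rewrite ?inE //; exact: measurableI.
- move=> t /= nP; have [It|nIt] := pselect (I t); [left; exact: PN|by right].
Qed.

Lemma ae_lebesgue_onW (P : set RT) :
  (forall t, t \in `[a, b] -> P t) -> {ae nu, forall t, P t}.
Proof.
move=> H; apply/ae_lebesgue_onP; rewrite (_ : _ `&` _ = set0).
  exact: negligible_set0.
by apply/seteqP; split => // t [It]; apply; exact: H.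
Qed.

Lemma L2norm_ge0 F : (0 <= L2norm a b F)%E.
Proof. exact: Lnorm_ge0. Qed.

Lemma sqr_L2norm F : (L2norm a b F ^+ 2 = \int[nu]_t (F t ^+ 2)%:E)%E.
Proof.
have e2 (x : \bar R) : (0 <= x -> x ^+ 2 = x `^ 2)%E.
  case: x => [x||] // x0; last by rewrite poweRyr // expe2 mulyy.
  by rewrite poweR_EFin powR_mulrn // EFin_expe.
rewrite e2 ?L2norm_ge0 // /L2norm poweR_Lnorm //.
apply: eq_integral => t _ /=.
by rewrite powR_mulrn // real_normK ?num_real.
Qed.

Lemma lee_sqr_EFin (x : \bar R) (y : R) : 0 <= y -> (0 <= x)%E ->
  (x ^+ 2 <= (y ^+ 2)%:E)%E -> (x <= y%:E)%E.
Proof.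
case: x => [x| |] y0 x0 //.
by rewrite -EFin_expe !lee_fin ler_sqr // nnegrE.
Qed.

Lemma L2norm_le F M : measurable_fun setT F -> 0 <= M ->
  {ae nu, forall t, `|F t| <= M} ->
  (L2norm a b F <= (M * Num.sqrt (b - a))%:E)%E.
Proof.
move=> mF M0 FM.
have ba : 0 <= b - a by rewrite subr_ge0 ltW.
apply: lee_sqr_EFin; [by rewrite mulr_ge0 ?sqrtr_ge0|exact: L2norm_ge0|].
rewrite sqr_L2norm exprMn sqr_sqrtr // EFinM -lebesgue_onT -integral_cst //.
apply: ae_ge0_le_integral => //.
- by move=> t _; rewrite lee_fin sqr_ge0.
- by apply/measurable_EFinP; exact: measurable_funX.
- by move=> t _; rewrite lee_fin sqr_ge0.
apply: filterS FM => t FM _ /=.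
by rewrite lee_fin -real_normK ?num_real // lerXn2r.
Qed.

(** [F] is sent to its class modulo almost everywhere equality; since [L2fun] reads a chosen
    representative of that class, [F] is recovered only almost everywhere. *)
Lemma L2_of_bounded F M : measurable_fun setT F -> (forall t, `|F t| <= M) ->
  exists f : L2 a b, {ae nu, forall t, L2fun f t = F t}.
Proof.
move=> mF FM.
have M0 : 0 <= M by apply: le_trans (FM 0).
pose Fm : {mfun RT >-> RT} := HB.pack F (isMeasurableFun.Build _ _ _ _ F mF).
pose q : {mfun_ nu, RT >-> RT} := (\pi_({mfun_ nu, RT >-> RT}) Fm)%qT.
have qF : {ae nu, forall t, (q : RT -> RT) t = F t}.
  have : (repr q == Fm %[mod {mfun_ nu, RT >-> RT}])%qT by rewrite reprK.
  rewrite eqmodE => /asboolP; apply: filterS => t; exact.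
have fin : finite_norm nu 2%:E (q : RT -> RT).
  apply: le_lt_trans (L2norm_le (M := M) _ M0 _) (ltry _) => //.
  by apply: filterS qF => t ->.
pose f : L2 a b := HB.pack q (isFinLebesgue.Build _ _ _ _ _ (lee1n 2) q fin).
by exists f.
Qed.

End L2Class.

Section L2Representatives.
Variables (R : realType) (a b : R).
Hypotheses (a0 : 0 < a) (ab : a < b).
Local Notation RT := (measurableTypeR R).
Local Notation mu := (@lebesgue_measure R).
Local Notation nu := (lebesgue_on a b).
Local Notation I := (`[a, b]%classic : set RT).
Implicit Types (F G : RT -> RT) (f g : L2 a b).

Lemma measurable_L2fun f : measurable_fun [set: RT] (L2fun f : RT -> RT).
Proof. exact: measurable_funPT. Qed.

Lemma eq_ae_L2norm F G : measurable_fun [set: RT] F -> measurable_fun [set: RT] G ->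
  {ae nu, forall t, F t = G t} -> L2norm a b F = L2norm a b G.
Proof.
move=> mF mG FG; rewrite /L2norm unlock; congr poweR.
apply: ae_eq_integral => //.
- apply: (measurableT_comp (measurable_poweR _)).
  by apply: measurableT_comp => //; exact/measurable_EFinP.
- apply: (measurableT_comp (measurable_poweR _)).
  by apply: measurableT_comp => //; exact/measurable_EFinP.
- by apply: filterS FG => t FG _ /=; rewrite FG.
Qed.

Lemma L2dist_triangle f g h : (L2dist f h <= L2dist f g + L2dist g h)%E.
Proof.
rewrite /L2dist /L2norm.
rewrite (_ : L2fun f \- L2fun h = (L2fun f \- L2fun g) \+ (L2fun g \- L2fun h)).
  apply: eminkowski; rewrite ?lee1n //; apply: measurable_funB; exact: measurable_L2fun.
by apply/funext => t /=; rewrite addrA subrK.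
Qed.

Lemma L2distC f g : L2dist f g = L2dist g f.
Proof.
rewrite /L2dist /L2norm -oppe_Lnorm; apply: eq_Lnorm => t /=.
by rewrite opprB.
Qed.

Lemma L2open_ball f (e : R) : L2open [set g | (L2dist g f < e%:E)%E].
Proof.
move=> g /= ge.
have gfin : L2dist g f \is a fin_num.
  by rewrite ge0_fin_numE ?L2norm_ge0 // (lt_trans ge) ?ltry.
exists (e - fine (L2dist g f)).
  by rewrite subr_gt0 -lte_fin fineK.
move=> h hg /=; apply: le_lt_trans (L2dist_triangle h g f) _.
rewrite -(fineK gfin); rewrite EFinB fineK // lteBrDr // in hg.
by rewrite fineK.
Qed.

Lemma mixture_densityE f F x : measurable_fun [set: RT] F ->
  {ae nu, forall t, L2fun f t = F t} ->
  mixture_density f x = gamma_mixture a b F x.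
Proof.
move=> mF fF; congr fine; apply: ae_eq_integral.
- exact: measurable_segment.
- apply/measurable_EFinP; apply: measurable_funM; last exact: measurable_gamma_density1.
  exact: measurable_funTS (measurable_L2fun f).
- apply/measurable_EFinP; apply: measurable_funM; last exact: measurable_gamma_density1.
  exact: measurable_funTS.
move/ae_lebesgue_onP: fF; apply: negligibleS => t /= /not_implyP[It fF].
by split => // ftF; apply: fF; rewrite ftF.
Qed.

Lemma densities_of_ae f F : measurable_fun [set: RT] F ->
  {ae nu, forall t, L2fun f t = F t} ->
  (forall t, t \in `[a, b] -> 0 <= F t) ->
  (\int[mu]_(t in `[a, b]) (F t)%:E = 1)%E -> densities f.
Proof.
move=> mF fF F0 F1; split.
  have H := ae_lebesgue_onW (a := a) (b := b) (P := fun t => 0 <= F t) F0.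
  by apply: (@filterS2 _ _ (ae_filter_ringOfSetsType nu) _ _ _ _ fF H) => t ->.
rewrite -F1; apply: ae_eq_integral.
- exact: measurable_segment.
- by apply/measurable_EFinP; apply: measurable_funTS; exact: measurable_L2fun.
- by apply/measurable_EFinP; exact: measurable_funTS.
move/ae_lebesgue_onP: fF; apply: negligibleS => t /= /not_implyP[It fF].
by split => // ftF; apply: fF; rewrite ftF.
Qed.

Lemma measurable_phi : measurable_fun [set: RT] (phi a b : RT -> RT).
Proof.
apply: measurableT_comp.
  by apply: continuous_measurable_fun; exact: sqrt_continuous.
by apply: measurable_funM; apply: measurable_funB.
Qed.

Lemma measurable_sym_diff r (h F : RT -> RT) :
  measurable_fun [set: RT] h -> measurable_fun [set: RT] F ->
  measurable_fun [set: RT] (fun x : RT => sym_diff a b r (h x) F x : RT).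
Proof.
move=> mh mF; rewrite /sym_diff.
have mlin c : measurable_fun [set: RT] (fun x : RT => x + c * h x : RT).
  by apply: measurable_funD => //; apply: measurable_funM.
have mmem c : measurable_fun [set: RT] (fun x : RT => x + c * h x \in `[a, b]).
  rewrite (_ : (fun x => _) = (fun x => (a <= x + c * h x) && (x + c * h x <= b))).
    apply: measurable_and; first exact: (measurable_fun_ler (measurable_cst a) (mlin c)).
    exact: (measurable_fun_ler (mlin c) (measurable_cst b)).
  by apply/funext => x; rewrite in_itv.
apply: measurable_fun_ifT => //.
  apply: measurable_and.
    by have := mmem (r%:R / 2); congr measurable_fun; apply/funext => x; rewrite mulrAC.
  by have := mmem (- (r%:R / 2)); congr measurable_fun; apply/funext => x; rewrite mulNr mulrAC.
rewrite (_ : (fun x => _) = (fun x => \sum_(i <- enum 'I_r.+1)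
    'C(r, i)%:R * (-1) ^+ i * F (x + (i%:R - r%:R / 2) * h x))).
  apply: measurable_sum => i; apply: measurable_funM => //.
  exact: (measurableT_comp mF (mlin _)).
by apply/funext => x; rewrite big_enum.
Qed.

(* [L2fun f] is an arbitrary representative of the class [f], and finite
   differences evaluate it at the points [x + c phi x]: they agree a.e. with
   those of [F] because null sets have null preimages under these maps. *)
Lemma smooth_class_of_ae (alpha C M B : R) f F :
  measurable_fun [set: RT] F -> {ae nu, forall t, L2fun f t = F t} ->
  0 <= M -> (forall t, `|F t| <= M) -> M * Num.sqrt (b - a) <= C ->
  let r := (Num.truncn alpha).+1 in
  0 <= B -> B * Num.sqrt (b - a) <= C ->
  (forall t h x, 0 < h <= t -> x \in `[a, b] ->
    `|\sum_(i < r.+1) 'C(r, i)%:R * (-1) ^+ i *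
        F (x + (i%:R - r%:R / 2) * (h * phi a b x))| <= B * t `^ alpha) ->
  smooth_class alpha C f.
Proof.
move=> mF fF M0 FM MC r B0 BC Fr; split.
  rewrite (eq_ae_L2norm (measurable_L2fun f) mF fF).
  apply: le_trans (L2norm_le ab mF M0 _) _; last by rewrite lee_fin.
  exact: aeW.
move=> t t0; apply: ge_ereal_sup => _ [h /andP[h0 ht] <-].
have mh : measurable_fun [set: RT] (fun x : RT => h * phi a b x : RT).
  by apply: measurable_funM => //; exact: measurable_phi.
have Bt0 : 0 <= B * t `^ alpha by rewrite mulr_ge0 // powR_ge0.
apply: le_trans (L2norm_le ab (measurable_sym_diff r mh (measurable_L2fun f)) Bt0 _) _; last first.
  by rewrite lee_fin mulrAC ler_wpM2r // powR_ge0.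
move/ae_lebesgue_onP: fF => N0; apply/ae_lebesgue_onP.
set N := (X in mu.-negligible X) in N0.
(* [bad i] collects the points whose i-th node falls where [L2fun f] and [F] differ. *)
pose bad (i : nat) := [set x | x \in `[a, b] /\ N (x + ((i%:R - r%:R / 2) * h) * phi a b x)].
have : mu.-negligible (\bigcup_i bad i).
  by apply: negligible_bigcup => i; exact: negligible_phi_preimage.
apply: negligibleS => x [Ix /= nx]; apply: contrapT => nbad; apply: nx.
rewrite /sym_diff; case: ifPn => [/andP[xr xl]|_]; last by rewrite normr0.
rewrite (eq_bigr (fun i : 'I_r.+1 => 'C(r, i)%:R * (-1) ^+ i *
        F (x + (i%:R - r%:R / 2) * (h * phi a b x)))).
  by apply: Fr => //; rewrite h0.
move=> i _; congr (_ * _); apply: contrapT => fxF; apply: nbad.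
exists i => //; split => //; rewrite -mulrA; split => //.
(* The almost everywhere equality is available on [a, b] only; the nodes lie there because they are
   between the two extreme ones, which the convention in [sym_diff] places in [a, b]. *)
move: xr xl; rewrite /= !in_itv /= -/(phi a b x) => /andP[_ xr] /andP[xl _].
have hp : 0 <= h * phi a b x by rewrite mulr_ge0 ?sqrtr_ge0 // ltW.
have ir : i%:R <= r%:R :> R by rewrite ler_nat -ltnS.
apply/andP; split.
  apply: le_trans xl _; rewrite lerD2l -mulrAC -mulNr ler_wpM2r // lerBrDr addrC subrr.
  by [].
apply: le_trans _ xr; rewrite lerD2l [leRHS]mulrAC ler_wpM2r //; lra.
Qed.

End L2Representatives.

(** * The two-point bound *)

Section TwoPoints.
Variables (R : realType) (a b : R) (n : nat).
Local Notation RT := (measurableTypeR R).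
Local Notation mu := (@lebesgue_measure R).
Implicit Types (f : L2 a b) (fhat : n.-tuple RT -> L2 a b).

(** The preimages of the half-lines [r, +oo[ are complements of preimages of open balls, which are
    Borel in L2. *)
Lemma measurable_L2dist_estimator fhat f : estimators fhat ->
  measurable_fun [set: n.-tuple RT] (fun x => L2dist (fhat x) f).
Proof.
move=> mfhat; apply: (measurability _ (ErealGenCInfty.measurableE R)).
move=> _ [_ [r ->] <-]; rewrite setTI.
have -> : (fun x => L2dist (fhat x) f) @^-1` `[r%:E, +oo[ =
    ~` (fhat @^-1` [set g | (L2dist g f < r%:E)%E]).
  apply/seteqP; split => x /=; rewrite in_itv /= andbT => h.
    by apply/negP; rewrite -leNgt.
  by rewrite leNgt; apply/negP.
apply: measurableC; apply: mfhat; apply: sub_sigma_algebra; exact: L2open_ball.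
Qed.

Lemma le_ereal_sqr (x : R) (y : \bar R) : 0 <= x -> (x%:E <= y)%E ->
  ((x ^+ 2)%:E <= y ^+ 2)%E.
Proof.
move=> x0; case: y => [y| |] //; last by move=> _; exact: leey.
by rewrite -EFin_expe !lee_fin => xy; rewrite lerXn2r // nnegrE (le_trans x0).
Qed.

(** Let [A] be the event that the estimate is within D / 2 of [f0]. Off [A] the loss at [f0] is at
    least D^2 / 4. On [A] the triangle inequality gives loss at least D^2 / 4 at [f1], and the
    likelihood under [f1] is at least half of that under [f0]. The two risks thus sum to at least
    D^2 / 8, and the larger is at least D^2 / 16; a one-sided comparison of likelihoods is
    enough. *)
Lemma two_point_risk (fhat : n.-tuple RT -> L2 a b) (f0 f1 : L2 a b)
    (q0 q1 : RT -> RT) (D : R) :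
  estimators fhat -> 0 <= D -> (D%:E <= L2dist f0 f1)%E ->
  (forall x, mixture_density f0 x = q0 x) ->
  (forall x, mixture_density f1 x = q1 x) ->
  measurable_fun setT q0 -> measurable_fun setT q1 ->
  (forall x, 0 <= q0 x) -> (forall x, 0 <= q1 x) ->
  (\int[mu]_x (q0 x)%:E = 1)%E ->
  (forall x : n.-tuple RT,
     \prod_(i < n) q0 (tnth x i) <= 2 * \prod_(i < n) q1 (tnth x i)) ->
  ((D ^+ 2 / 16)%:E <= maxe (risk fhat f0) (risk fhat f1))%E.
Proof.
move=> mfhat D0 Dd q0E q1E mq0 mq1 q00 q10 q01 q_le.
pose A := [set x | (L2dist (fhat x) f0 < (D / 2)%:E)%E].
have mA : measurable A.
  apply: (mfhat [set g | (L2dist g f0 < (D / 2)%:E)%E]).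
  apply: sub_sigma_algebra; exact: L2open_ball.
have mprod (q : RT -> RT) : measurable_fun setT q ->
    measurable_fun setT (fun x : n.-tuple RT => \prod_(i < n) q (tnth x i) : RT).
  move=> mq; apply: measurable_prod => i _; apply: (measurableT_comp mq).
  exact: measurable_tnth.
have prod0 (q : RT -> RT) (x : n.-tuple RT) : (forall x, 0 <= q x) ->
    0 <= \prod_(i < n) q (tnth x i).
  by move=> q_ge0; apply: prodr_ge0.
have riskE (f : L2 a b) (q : RT -> RT) : (forall x, mixture_density f x = q x) ->
    risk fhat f = (\int[lebesgue_power R n]_x
      (L2dist (fhat x) f ^+ 2 * (\prod_(i < n) q (tnth x i))%:E))%E.
  move=> qE; apply: eq_integral => x _; congr (_ * _%:E)%E.
  by apply: eq_bigr => i _.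
have mint (f : L2 a b) (q : RT -> RT) : measurable_fun setT q ->
    measurable_fun setT (fun x : n.-tuple RT =>
      (L2dist (fhat x) f ^+ 2 * (\prod_(i < n) q (tnth x i))%:E)%E).
  move=> mq; apply: emeasurable_funM; last by apply/measurable_EFinP; exact: mprod.
  under eq_fun do rewrite expe2.
  by apply: emeasurable_funM; exact: measurable_L2dist_estimator.
pose c := D ^+ 2 / 8.
have c0 : 0 <= c by rewrite divr_ge0 // sqr_ge0.
pose w (B : set (n.-tuple RT)) x := (c%:E * ((\1_B x)%:E * (\prod_(i < n) q0 (tnth x i))%:E))%E.
have w0 B x : (0 <= w B x)%E by rewrite /w -!EFinM lee_fin !mulr_ge0 // prod0.
have mw B : measurable B -> measurable_fun setT (w B).
  move=> mB; apply: emeasurable_funM => //; apply: emeasurable_funM; apply/measurable_EFinP.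
    exact: measurable_indic.
  exact: mprod.
have r0 : (\int[lebesgue_power R n]_x w (~` A) x <= risk fhat f0)%E.
  rewrite (riskE _ _ q0E); apply: ge0_le_integral => //.
  - by apply: mw; exact: measurableC.
  - exact: mint.
  move=> x _; rewrite /w muleA; apply: lee_wpmul2r; first by rewrite lee_fin prod0.
  rewrite indicE; have [/set_mem /negP|_] := boolP (x \in ~` A); last by rewrite mule0 sqre_ge0.
  rewrite -leNgt => h; rewrite mule1; apply: le_trans (le_ereal_sqr _ h); last by rewrite divr_ge0.
  by rewrite lee_fin /c; have := sqr_ge0 D; nra.
have r1 : (\int[lebesgue_power R n]_x w A x <= risk fhat f1)%E.
  rewrite (riskE _ _ q1E); apply: ge0_le_integral => //.
  - exact: mw.
  - exact: mint.
  move=> x _; rewrite /w indicE; have [/set_mem Ax|_] := boolP (x \in A); last first.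
    by rewrite mul0e mule0 mule_ge0 ?sqre_ge0 // lee_fin prod0.
  rewrite mul1e.
  have h : ((D / 2)%:E <= L2dist (fhat x) f1)%E.
    rewrite leNgt; apply/negP => h.
    have := le_lt_trans Dd (le_lt_trans (L2dist_triangle f0 (fhat x) f1) (lteD _ h)).
    rewrite L2distC => /(_ _ Ax); rewrite -EFinD lte_fin; lra.
  apply: (@le_trans _ _ ((D ^+ 2 / 4)%:E * (\prod_(i < n) q1 (tnth x i))%:E)%E).
    rewrite -!EFinM lee_fin /c; have := q_le x; have := sqr_ge0 D.
    move: (D ^+ 2) (\prod_(i < n) q0 _) (\prod_(i < n) q1 _) => d u v ? ?; nra.
  apply: lee_wpmul2r; first by rewrite lee_fin prod0.
  apply: le_trans (le_ereal_sqr _ h); last by rewrite divr_ge0.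
  by rewrite lee_fin expr_div_n; lra.
have : (c%:E <= risk fhat f0 + risk fhat f1)%E.
  apply: le_trans (leeD r0 r1).
  rewrite -ge0_integralD //; [|by apply: mw; exact: measurableC|exact: mw].
  rewrite (eq_integral (fun x => c%:E * (\prod_(i < n) q0 (tnth x i))%:E)%E); last first.
    move=> x _; rewrite /w -!EFinM -EFinD; congr EFin; rewrite -mulrDr -mulrDl.
    by rewrite !indicE in_setC; case: (_ \in _); rewrite /= ?addr0 ?add0r mul1r.
  rewrite ge0_integralZl_EFin //.
  - by rewrite integral_lebesgue_power_prod ?mule1.
  - by move=> x _; rewrite lee_fin prod0.
  - by apply/measurable_EFinP; exact: mprod.
move=> h; rewrite leNgt gt_max; apply/negP => /andP[h0 h1].
have := le_lt_trans h (lteD h0 h1).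
by rewrite -EFinD lte_fin /c; lra.
Qed.

End TwoPoints.

(** * The perturbed density *)

Lemma sum_bin_alt (R : comNzRingType) (r : nat) :
  \sum_(i < r.+2) 'C(r.+1, i)%:R * (-1) ^+ i = 0 :> R.
Proof.
transitivity ((1 - 1) ^+ r.+1 : R); last by rewrite subrr expr0n.
rewrite exprDn; apply: eq_bigr => i _.
by rewrite expr1n mul1r mulr_natl.
Qed.

(** Serves for steps longer than the cells, where the derivative bound is too weak. *)
Lemma finite_difference_le_sup (R : realDomainType) (r : nat) (f : nat -> R) (A : R) :
  (forall i, `|f i| <= A) ->
  `|\sum_(i < r.+1) 'C(r, i)%:R * (-1) ^+ i * f i| <= A * 2 ^+ r.
Proof.
move=> fA; apply: le_trans (ler_norm_sum _ _ _) _.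
have -> : 2 ^+ r = \sum_(i < r.+1) 'C(r, i)%:R :> R.
  have -> : 2 = 1 + 1 :> R by rewrite -natr1.
  by rewrite exprDn; apply: eq_bigr => i _; rewrite !expr1n mul1r.
rewrite mulr_sumr; apply: ler_sum => i _.
rewrite !normrM normrX normrN normr1 expr1n mulr1 mulrC normr_nat.
by rewrite ler_wpM2r.
Qed.

Lemma bernoulli_subr (R : realFieldType) (x : R) (n : nat) :
  0 <= x <= 1 -> 1 - n%:R * x <= (1 - x) ^+ n.
Proof.
move=> /andP[x0 x1]; elim: n => [|n IH]; first by rewrite mul0r subr0 expr0.
rewrite exprS; apply: (@le_trans _ _ ((1 - x) * (1 - n%:R * x))).
  rewrite -natr1 -subr_ge0.
  have -> : (1 - x) * (1 - n%:R * x) - (1 - (n%:R + 1) * x) = n%:R * x ^+ 2 by ring.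
  by rewrite mulr_ge0 ?sqr_ge0.
by rewrite ler_wpM2l ?subr_ge0.
Qed.

Lemma lee_EFin_sqr (R : realType) (y : R) (x : \bar R) : 0 <= y -> (0 <= x)%E ->
  ((y ^+ 2)%:E <= x ^+ 2)%E -> (y%:E <= x)%E.
Proof.
case: x => [x| |] y0 x0 //; first by rewrite -EFin_expe !lee_fin ler_sqr // nnegrE.
by move=> _; exact: leey.
Qed.

(* [m] moments weighted by [1 / Gamma] and the total mass are [m.+1] linear
   constraints on the [2 m.+1] coefficients. *)
Lemma moment_free_weights (R : realType) (a b : R) (V : R -> R) (m : nat) (s e : R) :
  0 < a -> a < b -> continuous V -> (forall y, 0 <= V y <= 1) ->
  exists w : 'I_(2 * m.+1) -> R, [/\ forall j, `|w j| <= 1,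
    (m.+1 <= #|[set j | (`|w j| == 1)%R]%SET|)%N,
    \int[@lebesgue_measure R]_(t in `[a, b]) lattice_sum w V s e t = 0 &
    forall k, (k < m)%N -> \int[@lebesgue_measure R]_(t in `[a, b])
      (lattice_sum w V s e t / Gamma t * (t - (a + b) / 2) ^+ k) = 0].
Proof.
move=> a0 ab cV V1.
have cVj (j : nat) : continuous (fun t : R => V ((t - s) / e - j%:R)).
  move=> t; apply: continuous_comp; last exact: cV.
  by apply: cvgB; [apply: cvgMl; apply: cvgB; [exact: cvg_id|exact: cvg_cst]|exact: cvg_cst].
pose Vj (j : nat) (t : R) := V ((t - s) / e - j%:R).
(* Indices below [m] encode the weighted moments, and index [m] the total mass. *)
pose G k (t : R) : R := if (k < m)%N then (Gamma t)^-1 * (t - (a + b) / 2) ^+ k else 1.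
have mG k : measurable_fun [set: measurableTypeR R] (G k : measurableTypeR R -> measurableTypeR R).
  rewrite /G; case: (k < m)%N => //.
  exact: measurable_moment_weight.
have GB k : exists B, forall t, t \in `[a, b] -> `|G k t| <= B.
  rewrite /G; case: (k < m)%N; first exact: moment_weight_bounded.
  by exists 1 => t _; rewrite normr1.
have [B HB] := choice GB.
have mVG (j : nat) k : measurable_fun (`[a, b]%classic : set (measurableTypeR R))
    (fun t : measurableTypeR R => Vj j t * G k t : measurableTypeR R).
  apply: measurable_funTS; apply: measurable_funM; last exact: mG.
  by apply: continuous_measurable_fun; exact: cVj.
have VGB (j : nat) k t : t \in `[a, b] -> `|Vj j t * G k t| <= B k.
  move=> It; rewrite normrM; apply: le_trans (HB k t It); rewrite ler_piMl //.
  by have /andP[v0 v1] := V1 ((t - s) / e - j%:R); rewrite ger0_norm.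
pose A : 'M[R]_(2 * m.+1, m.+1) :=
  \matrix_(j, k) \int[@lebesgue_measure R]_(t in `[a, b]) (Vj j t * G k t).
have [w [wA w1 wc]] := flat_row_vector A.
have Gw k : (k <= m)%N ->
    \int[@lebesgue_measure R]_(t in `[a, b]) (lattice_sum (w 0) V s e t * G k t) = 0.
  move=> km.
  have := congr1 (fun M : 'rV_m.+1 => M 0 (inord k)) wA; rewrite !mxE => E.
  rewrite -[RHS]E.
  have expand t : lattice_sum (w 0) V s e t * G k t =
      \sum_(j < 2 * m.+1) w 0 j * (Vj j t * G k t).
    by rewrite /lattice_sum mulr_suml; apply: eq_bigr => j _; rewrite mulrA.
  under eq_Rintegral do rewrite expand.
  rewrite (@Rintegral_segment_sum R a b (ltW ab) _ _
    (fun (j : 'I_(2 * m.+1)) t => w 0 j * (Vj j t * G k t)) (fun j => B k)).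
  - apply: eq_bigr => j _; rewrite mxE inordK ?ltnS //.
    rewrite RintegralZl //.
    apply: (bounded_integrable_segment (ltW ab) (mVG j k)) => t It; exact: VGB.
  - by move=> j; apply: measurable_funM => //; exact: mVG.
  - move=> j t It; rewrite normrM; apply: le_trans (VGB j k t It).
    by rewrite ler_piMl.
exists (w 0); split => //.
- by apply: leq_trans wc; rewrite mul2n -addnn addnK.
- have := Gw m (leqnn m); rewrite /G ltnn.
  by under eq_Rintegral do rewrite mulr1.
- move=> k km; have := Gw k (ltnW km); rewrite /G km.
  by under eq_Rintegral do rewrite mulrA.
Qed.

(** With z = h M, min(1, z^r) <= z^alpha because 0 < alpha <= r. This merges the sup bound and the
    derivative bound into the smoothness condition, and fixes the height M^-alpha. *)
Lemma powR_scaled_min (R : realType) (alpha M h : R) (r : nat) :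
  0 < alpha -> alpha <= r%:R -> 0 < M -> 0 < h ->
  M `^ (- alpha) * Num.min 1 ((h * M) ^+ r) <= h `^ alpha.
Proof.
move=> alpha0 ar M0 h0.
have hM0 : 0 < h * M by rewrite mulr_gt0.
have -> : h `^ alpha = M `^ (- alpha) * (h * M) `^ alpha.
  rewrite powRM ?(ltW h0) ?(ltW M0) // powRN mulrCA mulVf ?mulr1 //.
  by rewrite gt_eqF // powR_gt0.
rewrite ler_wpM2l ?powR_ge0 // ge_min.
have [hM1|/ltW hM1] := leP (h * M) 1.
  by rewrite -powR_mulrn ?(ltW hM0) // ger_powR ?hM0 // orbT.
by rewrite -[X in X <= _](powRr0 (h * M)) ler_powR ?(ltW alpha0).
Qed.

Section Perturbation.
Variables (R : realType) (a b C alpha : R).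
Hypotheses (a0 : 0 < a) (ab : a < b) (bC : (b - a) `^ (- 2^-1) < C) (alpha1 : 1 < alpha).
Local Notation RT := (measurableTypeR R).
Local Notation mu := (@lebesgue_measure R).
Local Notation mid := ((a + b) / 2).
Local Notation r := (Num.truncn alpha).+1.
Local Notation s := (expR 2 : R).
Local Notation u := ((b - a)^-1).

(** This is the L2 norm of the uniform density; [bC] therefore leaves a positive slack for the
    perturbation. *)
Let sqrt_inv : (b - a) `^ (- 2^-1) = u * Num.sqrt (b - a).
Proof.
have ba : 0 < b - a by rewrite subr_gt0.
have sq0 : Num.sqrt (b - a) != 0 by rewrite gt_eqF // sqrtr_gt0.
rewrite powRN powR12_sqrt ?(ltW ba) //; apply: (mulIf sq0).
by rewrite mulVf // -mulrA -expr2 sqr_sqrtr ?(ltW ba) // mulVf // gt_eqF.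
Qed.

Let integral_uniform : (\int[mu]_(t in `[a, b]) u%:E = 1)%E.
Proof.
rewrite integral_cst; last exact: measurable_segment.
rewrite [X in (_ * X)%E](_ : _ = (b - a)%:E); last exact: (lebesgue_measure_segment (ltW ab)).
by rewrite -EFinM mulVf // gt_eqF // subr_gt0.
Qed.

Lemma uniform_in_class : exists f : L2 a b,
  [/\ {ae lebesgue_on a b, forall t, L2fun f t = u}, smooth_class alpha C f & densities f].
Proof.
have ba : 0 < b - a by rewrite subr_gt0.
have u0 : 0 <= u by rewrite invr_ge0 ltW.
have mu0 : measurable_fun [set: RT] (cst u : RT -> RT) by exact: measurable_cst.
have C0 : 0 <= C by apply: le_trans (ltW bC); exact: powR_ge0.
have uM (t : RT) : `|(cst u : RT -> RT) t| <= u by rewrite ger0_norm.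
have [f fu] := L2_of_bounded ab mu0 uM.
exists f; split => //.
  apply: (smooth_class_of_ae ab (M := u) (B := 0) mu0 fu) => //; rewrite ?mul0r //.
  - by rewrite -sqrt_inv ltW.
  - move=> t h x _ _; rewrite mul0r.
    by rewrite -mulr_suml sum_bin_alt mul0r normr0.
by apply: (densities_of_ae mu0 fu) => //.
Qed.

(** The constants [c] and [K] are chosen before [m], so that [m] can later grow with the sample
    size; separation decays polynomially in [m] while the mixtures merge exponentially. *)
Lemma perturbed_pair : exists (c K : R), [/\ 0 < c, 0 <= K & forall m : nat,
  exists (f0 f1 : L2 a b) (q0 q1 : RT -> RT),
   [/\ [/\ smooth_class alpha C f0, densities f0, smooth_class alpha C f1 & densities f1],
     ((c * m.+1%:R `^ (- alpha))%:E <= L2dist f0 f1)%E,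
     (forall x, mixture_density f0 x = q0 x) /\ (forall x, mixture_density f1 x = q1 x),
     [/\ measurable_fun setT q0, measurable_fun setT q1, forall x, 0 <= q0 x,
       forall x, 0 <= q1 x & (\int[mu]_x (q0 x)%:E = 1)%E] &
     forall x, (1 - K * s ^- m) * q0 x <= q1 x]].
Proof.
have ba : 0 < b - a by rewrite subr_gt0.
have u0 : 0 < u by rewrite invr_gt0.
have s1 : 1 <= s by rewrite -[X in X <= _]expR0 ler_expR.
have s0 : 0 < s := expR_gt0 _.
have sq0 : 0 < Num.sqrt (b - a) by rewrite sqrtr_gt0.
have [V [K0 [c [c0 cV [V0 V1] Vc Vdiff]]]] := smooth_lattice_bump R (r := r) isT.
have [Kg Kg0 KgP] := gamma_mixture_small a0 ab.
(* 2^r is the sup bound on differences. The other term is the derivative bound: for cells of width e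
   = (b - a) / (4 s M), a step h phi <= h (b - a) is at most 4 s h M cells long. *)
pose K' := 2 ^+ r + `|K0| * (4 * s) ^+ r.
have K'0 : 0 < K' by rewrite ltr_wpDr ?exprn_gt0 // mulr_ge0 // exprn_ge0 // mulr_ge0 // ltW.
have slack : 0 < C - u * Num.sqrt (b - a) by rewrite subr_gt0 -sqrt_inv.
have C0 : 0 < C by apply: le_lt_trans bC; exact: powR_ge0.
(* The three entries ensure respectively that u + g stays nonnegative, that its L2 norm is at most
   [C], and that its modulus of smoothness is at most C t^alpha. *)
pose c1 := Num.min u (Num.min ((C - u * Num.sqrt (b - a)) / Num.sqrt (b - a))
  (C / (K' * Num.sqrt (b - a)))).
have c10 : 0 < c1 by rewrite !lt_min u0 !divr_gt0 // mulr_gt0.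
have c1u : c1 <= u by rewrite ge_min lexx.
have c1C : (u + c1) * Num.sqrt (b - a) <= C.
  rewrite mulrDl -lerBrDl -ler_pdivlMr //.
  by rewrite /c1 !ge_min lexx !orbT.
have c1K : c1 * K' * Num.sqrt (b - a) <= C.
  rewrite -mulrA -ler_pdivlMr ?mulr_gt0 //.
  by rewrite /c1 !ge_min lexx !orbT.
(* The window radius required by [gamma_mixture_small] for the base s = e^2; the 2M cells of width d
   / M fill exactly the window. *)
pose d := (b - a) / (4 * s).
have d0 : 0 < d by rewrite divr_gt0 // mulr_gt0.
have dba : d <= (b - a) / 4.
  by rewrite ler_pM2l // lef_pV2 ?posrE ?mulr_gt0 // ler_peMr.
have [f0 [f0u f0s f0d]] := uniform_in_class.
(* The squared L2 norm of g is at least A^2 c^2 (e / 2) M, with A = c1 M^-alpha, e M = d and at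
   least M = m + 1 saturated bumps. In the second constant, A <= c1, and u converts the mixture of
   the constant 1 into that of f0. *)
exists (c1 * c * Num.sqrt (d / 2)), (Kg * c1 / u); split.
- by rewrite !mulr_gt0 // sqrtr_gt0 divr_gt0.
- by rewrite divr_ge0 ?mulr_ge0 // ltW.
move=> m; pose M : R := m.+1%:R.
have M0 : 0 < M by rewrite ltr0n.
pose e := d / M.
have e0 : 0 < e by rewrite divr_gt0.
have E : (2 * m.+1)%:R * e = 2 * d.
  by rewrite natrM -/M /e; field; rewrite gt_eqF.
pose st := mid - d.
have [w [w1 wc wmass wmom]] := moment_free_weights m st e a0 ab cV V1.
pose A := c1 * M `^ (- alpha).
have A0 : 0 <= A by rewrite mulr_ge0 ?powR_ge0 // ltW.
have Ac1 : A <= c1.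
  rewrite /A ler_piMr ?(ltW c10) // -[X in _ <= X](powRr0 M) ler_powR ?oppr_le0 ?ler1n //.
  by rewrite (le_trans _ (ltW alpha1)).
pose G (t : RT) : RT := A * lattice_sum w V st e t.
have V1' y : `|V y| <= 1 by have /andP[v0 v1] := V1 y; rewrite ger0_norm.
have GA t : `|G t| <= A.
  rewrite normrM (ger0_norm A0) ler_piMr //; exact: lattice_sum_le.
have mL : measurable_fun [set: RT] (lattice_sum w V st e : RT -> RT).
  by apply: continuous_measurable_fun; exact: continuous_lattice_sum.
have mG : measurable_fun [set: RT] G by exact: measurable_funM.
have Gsupp t : d <= `|t - mid| -> G t = 0.
  move=> dt; rewrite /G lattice_sum_supp ?mulr0 //.
  apply/negP => /andP[t1 t2]; move: dt; apply/negP; rewrite -ltNge ltr_norml.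
  by move: t1 t2; rewrite /st E => t1 t2; apply/andP; split; lra.
pose F (t : RT) : RT := u + G t.
have F0 t : 0 <= F t.
  have := GA t; rewrite ler_norml /F => /andP[+ _]; have := le_trans Ac1 c1u; lra.
have FM t : `|F t| <= u + c1.
  by rewrite ger0_norm // /F lerD2l (le_trans _ Ac1) // (le_trans (ler_norm _)).
have mF : measurable_fun [set: RT] F by exact: measurable_funD.
have [f1 f1F] := L2_of_bounded ab mF FM.
have mI : measurable (`[a, b]%classic : set RT) by exact: measurable_segment.
have mcu : measurable_fun [set: RT] (cst u : RT -> RT) by exact: measurable_cst.
have uM (t : RT) : `|(cst u : RT -> RT) t| <= u by rewrite ger0_norm //; exact: ltW.
have ic : mu.-integrable (`[a, b]%classic : set RT) (EFin \o (cst u : RT -> RT)).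
  by apply: (bounded_integrable_segment (ltW ab) (B := u)) => // t _; exact: uM.
have iL : mu.-integrable (`[a, b]%classic : set RT) (EFin \o (lattice_sum w V st e : RT -> RT)).
  apply: (bounded_integrable_segment (ltW ab) (B := 1)) => [|t _]; first exact: measurable_funTS.
  exact: lattice_sum_le.
have iG : mu.-integrable (`[a, b]%classic : set RT) (EFin \o G).
  by apply: (bounded_integrable_segment (ltW ab) (B := A)) => [|t _ //]; exact: measurable_funTS.
have iF : mu.-integrable (`[a, b]%classic : set RT) (EFin \o F).
  by apply: (bounded_integrable_segment (ltW ab) (B := u + c1)) => [|t _ //]; exact: measurable_funTS.
exists f0, f1, (gamma_mixture a b (fun=> u)), (gamma_mixture a b F); split.
- have [f1s f1d] : smooth_class alpha C f1 /\ densities f1; last by split.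
  split; last first.
    apply: (densities_of_ae mF f1F) => //.
    rewrite -[LHS]fineK; last exact: integrable_fin_num iF.
    congr EFin; transitivity (\int[mu]_(t in `[a, b]) F t) => //.
    rewrite RintegralD // RintegralZl // wmass mulr0 addr0.
    by rewrite /Rintegral integral_uniform.
  apply: (smooth_class_of_ae ab (M := u + c1) (B := c1 * K') mF f1F) => //.
  + by rewrite addr_ge0 // ltW.
  + by rewrite mulr_ge0 ?ltW.
  move=> t h x /andP[h0 ht] Ix.
  set v := h * phi a b x.
  have -> : \sum_(i < r.+1) 'C(r, i)%:R * (-1) ^+ i * F (x + (i%:R - r%:R / 2) * v) =
     A * \sum_(i < r.+1) 'C(r, i)%:R * (-1) ^+ i *
       lattice_sum w V st e (x + (i%:R - r%:R / 2) * v).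
    under eq_bigr do rewrite /F mulrDr.
    rewrite big_split /= -mulr_suml sum_bin_alt mul0r add0r mulr_sumr.
    by apply: eq_bigr => i _; rewrite /G mulrCA.
  rewrite normrM (ger0_norm A0); set S := `|_|.
  have S1 : S <= 2 ^+ r.
    rewrite -[X in _ <= X]mul1r.
    apply: (@finite_difference_le_sup _ _ (fun i => lattice_sum w V st e (x + (i%:R - r%:R / 2) * v))).
    by move=> i; exact: lattice_sum_le.
  have S2 : S <= `|K0| * (4 * s) ^+ r * (h * M) ^+ r.
    apply: le_trans (Vdiff _ w st e v x e0 w1) _.
    apply: le_trans (ler_wpM2r _ (ler_norm K0)) _; first by rewrite exprn_ge0 // divr_ge0 // ltW.
    rewrite -mulrA ler_wpM2l // -exprMn lerXn2r ?nnegrE //.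
    - by rewrite divr_ge0 // ltW.
    - by rewrite !mulr_ge0 // ltW.
    rewrite ger0_norm; last by rewrite mulr_ge0 ?sqrtr_ge0 // ltW.
    have -> : 4 * s * (h * M) = h * (b - a) / e.
      by rewrite /e /d; field; rewrite !gt_eqF.
    by rewrite ler_wpM2r ?invr_ge0 ?(ltW e0) // ler_wpM2l ?(ltW h0) // phi_le.
  have S3 : S <= K' * Num.min 1 ((h * M) ^+ r).
    have K1 : 0 <= `|K0| * (4 * s) ^+ r by rewrite mulr_ge0 // exprn_ge0 // mulr_ge0 // ltW.
    have K2 : 0 <= 2 ^+ r :> R by rewrite exprn_ge0.
    have hMr : 0 <= (h * M) ^+ r by rewrite exprn_ge0 // mulr_ge0 // ltW.
    rewrite /K' /Num.min; case: ifP => _.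
      by rewrite mulr1; apply: le_trans S1 _; rewrite lerDl.
    by apply: le_trans S2 _; rewrite ler_wpM2r // lerDr.
  apply: le_trans (ler_wpM2l A0 S3) _.
  have -> : A * (K' * Num.min 1 ((h * M) ^+ r)) =
      c1 * K' * (M `^ (- alpha) * Num.min 1 ((h * M) ^+ r)) by rewrite /A; ring.
  rewrite ler_wpM2l ?mulr_ge0 ?(ltW c10) ?(ltW K'0) //.
  have alpha0 : 0 < alpha by apply: lt_trans alpha1.
  apply: le_trans (powR_scaled_min alpha0 _ M0 h0) _; first exact/ltW/truncnS_gt.
  by rewrite ge0_ler_powR ?nnegrE ?(ltW alpha0) ?(ltW h0) // (le_trans (ltW h0)).
- apply: lee_EFin_sqr; [by rewrite !mulr_ge0 ?powR_ge0 ?sqrtr_ge0 ?(ltW c10) ?(ltW c0)|exact: L2norm_ge0|].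
  rewrite /L2dist (eq_ae_L2norm (G := fun t => - G t)); last 3 first.
  + by apply: measurable_funB; exact: measurable_L2fun.
  + exact: measurable_funN.
  + apply: (@filterS2 _ _ (ae_filter_ringOfSetsType (lebesgue_on a b)) _ _ _ _ f0u f1F).
    by move=> t /= -> ->; rewrite /F; ring.
  rewrite sqr_L2norm.
  have -> : (\int[lebesgue_on a b]_t ((- G t) ^+ 2)%:E =
     (A ^+ 2)%:E * \int[lebesgue_on a b]_t (lattice_sum w V st e t ^+ 2)%:E)%E.
    rewrite -ge0_integralZl_EFin ?sqr_ge0 //.
    + by apply: eq_integral => t _; rewrite sqrrN exprMn EFinM.
    + by move=> t _; rewrite lee_fin sqr_ge0.
    + by apply/measurable_EFinP; exact: measurable_funX.
  have := @lattice_sum_sqr_integral_ge R a b _ w V c st e (ltW c0) e0.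
  move=> /(_ _ _ cV V0 Vc) H.
  apply: (@le_trans _ _ ((A ^+ 2)%:E * (c ^+ 2 * (e / 2) * M)%:E)%E).
    rewrite -EFinM lee_fin le_eqVlt; apply/orP; left; apply/eqP.
    have d20 : 0 <= d / 2 by rewrite divr_ge0 // ltW.
    rewrite !exprMn sqr_sqrtr // /A /e.
    by field; rewrite gt_eqF.
  apply: lee_wpmul2l; first by rewrite lee_fin sqr_ge0.
  apply: le_trans (H _ _).
  + by rewrite lee_fin ler_wpM2l ?ler_nat // mulr_ge0 ?sqr_ge0 // divr_ge0 // ltW.
  + rewrite /st; lra.
  + rewrite E /st; lra.
- by split => x; apply: mixture_densityE.
- split => //.
  + by apply: measurable_gamma_mixture => // t _; exact: ltW.
  + by apply: measurable_gamma_mixture.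
  + by move=> x; apply: gamma_mixture_ge0 => // t _; exact: ltW.
  + by move=> x; apply: gamma_mixture_ge0.
  + rewrite (integral_gamma_mixture a0 ab (A := u)) //.
    by move=> t _; rewrite lexx andbT ltW.
- move=> x.
  have -> : gamma_mixture a b F x = gamma_mixture a b (fun=> u) x + gamma_mixture a b G x.
    rewrite /gamma_mixture -RintegralD //.
    + by apply: eq_Rintegral => t _; rewrite mulrDl.
    + by apply: (gamma_mixture_integrable a0 ab (A := u)) => // t _; exact: uM.
    + by apply: (gamma_mixture_integrable a0 ab (A := A)) => //; exact: measurable_funTS.
  have -> : gamma_mixture a b (fun=> u) x = u * gamma_mixture a b (fun=> 1) x.
    rewrite /gamma_mixture -RintegralZl //.
      by apply: eq_Rintegral => t _; rewrite mul1r.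
    by apply: (gamma_mixture_integrable a0 ab (A := 1)) => // t _; rewrite normr1.
  have := KgP s A m G s1 mG GA Gsupp _ x.
  have g1 : 0 <= gamma_mixture a b (fun=> 1) x by apply: gamma_mixture_ge0.
  move=> /(_ _) H.
  have {}H : `|gamma_mixture a b G x| <= Kg * A * s ^- m * gamma_mixture a b (fun=> 1) x.
    apply: H => k km; rewrite -[RHS](mulr0 A) -(wmom k km) -RintegralZl //.
      by apply: eq_Rintegral => t _; rewrite /G !mulrA.
    have [B HB] := moment_weight_bounded a0 ab k.
    apply: (bounded_integrable_segment (ltW ab) (B := B)) => [|t It].
      rewrite (_ : (fun t => _) = (fun t : RT => lattice_sum w V st e t *
          ((Gamma t)^-1 * (t - mid) ^+ k))).
        by apply: measurable_funTS; apply: measurable_funM; last exact: measurable_moment_weight.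
      by apply/funext => t; rewrite mulrA.
    rewrite -mulrA normrM; apply: le_trans (HB t It); rewrite ler_piMl //.
    exact: lattice_sum_le.
  have : Kg * A * s ^- m * gamma_mixture a b (fun=> 1) x <=
         Kg * c1 * s ^- m * gamma_mixture a b (fun=> 1) x.
    rewrite ler_wpM2r // ler_wpM2r ?invr_ge0 ?exprn_ge0 ?(ltW s0) // ler_wpM2l //.
    exact: ltW.
  move=> /(le_trans H); rewrite ler_norml => /andP[H1 _].
  have -> : (1 - Kg * c1 / u * s ^- m) * (u * gamma_mixture a b (fun=> 1) x) =
    u * gamma_mixture a b (fun=> 1) x - Kg * c1 * s ^- m * gamma_mixture a b (fun=> 1) x.
    by field; rewrite !gt_eqF // exprn_gt0.
  by rewrite lerD2l.
Qed.

End Perturbation.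

(** * Choice of the number of moments and conclusion *)

Lemma minimax_risk_ge (R : realType) (a b C alpha : R) (n : nat) (f0 f1 : L2 a b)
    (B : \bar R) :
  smooth_class alpha C f0 -> densities f0 ->
  smooth_class alpha C f1 -> densities f1 ->
  (forall fhat, @estimators R a b n fhat ->
    (B <= maxe (risk fhat f0) (risk fhat f1))%E) ->
  (B <= minimax_risk a b alpha C n)%E.
Proof.
move=> f0s f0d f1s f1d HB; apply: le_ereal_inf_tmp => _ [fhat efhat <-].
apply: le_trans (HB _ efhat) _; rewrite ge_max; apply/andP; split.
  by apply: ereal_sup_ubound; exists f0.
by apply: ereal_sup_ubound; exists f1.
Qed.

Theorem theorem5 (R : realType) (a b C alpha : R)
    (ha : 0 < a) (hab : a < b) (hC : (b - a) `^ (- 2^-1) < C)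
    (halpha : 1 < alpha) :
  exists2 Cstar : R, 0 < Cstar &
  exists2 eps : nat -> R, eps n @[n --> \oo] --> 0 &
    \forall n \near \oo,
      ((Cstar * (ln n%:R) `^ (- (2 * alpha)) * (1 + eps n))%:E
        <= minimax_risk a b alpha C n)%E.
Proof.
have [c [K [c0 K0 Hpair]]] := perturbed_pair ha hab hC halpha.
(* 1/16 comes from the two-point bound, and 3 from m + 1 <= 3 ln n. *)
exists (c ^+ 2 / 16 * 3 `^ (- (2 * alpha))).
  by rewrite mulr_gt0 ?powR_gt0 // divr_gt0 // exprn_gt0.
(* The inequality holds exactly for all large n, so the o(1) term is taken to be zero. *)
exists (fun=> 0); first exact: cvg_cst.
near=> n.
have n1 : expR 1 <= n%:R :> R by near: n; exact: nbhs_infty_ger.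
have nK : 2 * K <= n%:R :> R by near: n; exact: nbhs_infty_ger.
have n0 : 0 < n%:R :> R by apply: lt_le_trans n1; exact: expR_gt0.
have ln1 : 1 <= ln n%:R :> R by rewrite -[X in X <= _](expRK 1) ler_ln ?posrE ?expR_gt0.
(* The least order that is sure to exceed ln n after truncation; m + 1 is at most ln n + 2, hence at
   most 3 ln n once n >= e. *)
pose m := (Num.truncn (ln n%:R : R)).+1.
have lnm : ln n%:R <= m%:R :> R by exact/ltW/truncnS_gt.
have mln : m.+1%:R <= 3 * ln n%:R :> R.
  have : (Num.truncn (ln n%:R : R))%:R <= ln n%:R :> R by rewrite truncn_le (le_trans _ ln1).
  by rewrite /m -(natr1 _.+1) -(natr1 (Num.truncn _)) => h; lra.
have [f0 [f1 [q0 [q1 [[f0s f0d f1s f1d] fdist [q0E q1E] [mq0 mq1 q00 q10 q01] q01le]]]]] :=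
  Hpair m.
set eps := K * expR 2 ^- m in q01le.
have eps0 : 0 <= eps by rewrite mulr_ge0 // invr_ge0 exprn_ge0 // expR_ge0.
(* As m >= ln n, e^(-2 m) <= n^-2, so n eps <= K / n <= 1/2. The base e^2 was chosen for this: with
   base e the bound would only be n eps <= K. *)
have neps : n%:R * eps <= 2^-1.
  have h : n%:R ^+ 2 <= expR 2 ^+ m :> R.
    rewrite -expRM_natr -[X in X ^+ 2](lnK n0) -expRM_natl ler_expR.
    by rewrite ler_wpM2l.
  rewrite /eps mulrA ler_pdivrMr ?exprn_gt0 ?expR_gt0 //.
  apply: le_trans (_ : 2^-1 * n%:R ^+ 2 <= _); last by rewrite ler_wpM2l ?invr_ge0.
  by rewrite expr2 mulrA mulrC ler_wpM2r ?(ltW n0) //; lra.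
have n1' : 1 <= n%:R :> R by apply: le_trans n1; rewrite -[X in X <= _]expR0 ler_expR.
have eps1 : eps <= 1.
  apply: le_trans (_ : n%:R * eps <= _); last by lra.
  by rewrite ler_peMl.
have q_le (x : n.-tuple (measurableTypeR R)) :
    \prod_(i < n) q0 (tnth x i) <= 2 * \prod_(i < n) q1 (tnth x i).
  have P0 : 0 <= \prod_(i < n) q0 (tnth x i) by apply: prodr_ge0.
  (* The pointwise comparison is multiplied over the observations; Bernoulli's inequality then gives
     (1 - eps)^n >= 1 - n eps >= 1/2, whence the factor 2. *)
  have : (1 - eps) ^+ n * \prod_(i < n) q0 (tnth x i) <= \prod_(i < n) q1 (tnth x i).
    rewrite -[X in (1 - eps) ^+ X](card_ord n) -prodr_const -big_split /=.
    by apply: ler_prod => i _; rewrite q01le andbT mulr_ge0 // subr_ge0.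
  have : 2^-1 <= (1 - eps) ^+ n.
    by apply: le_trans (bernoulli_subr n _); [lra|rewrite eps0].
  by nra.
set D := c * m.+1%:R `^ (- alpha) in fdist.
have D0 : 0 <= D by rewrite mulr_ge0 ?powR_ge0 // ltW.
apply: le_trans (minimax_risk_ge f0s f0d f1s f1d (fun fhat efhat =>
  two_point_risk efhat D0 fdist q0E q1E mq0 mq1 q00 q10 q01 q_le)).
have M0 : 0 < m.+1%:R :> R by rewrite ltr0n.
have rate : (ln n%:R * 3) `^ (- (2 * alpha)) <= (m.+1%:R `^ (- alpha)) ^+ 2.
  rewrite -powR_mulrn ?powR_ge0 // -powRrM mulNr (mulrC alpha) !powRN.
  rewrite lef_pV2 ?posrE ?powR_gt0 //; last by rewrite mulr_gt0 // (lt_le_trans _ ln1).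
  by rewrite ge0_ler_powR ?nnegrE ?(ltW M0) //; lra.
rewrite lee_fin addr0 mulr1 /D exprMn mulrAC -[X in X <= _]mulrA -powRM //; last first.
  by rewrite (le_trans _ ln1).
by rewrite [X in _ <= X]mulrAC ler_wpM2l // divr_ge0 // exprn_ge0 // ltW.
Unshelve. all: by end_near. Qed.
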